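(* Let $K\subset\mathbb R^d$ be compact and let $F:\mathbb R^d\to\mathbb R$ be measurable, $C^4$ on a neighbourhood of $0$, and satisfy $$|F(u)|\le C(1+\|u\|^D),\qquad u\in\mathbb R^d,$$ for some $D>0$ (and some constant $C$). Suppose that $$p>\max\{4,D\},\qquad q>\max\{3,D\},\qquad X\in L^p,\qquad Y,Z,W,M\in L^q,$$ where $X,Y,Z,W,M$ are real random variables on a common probability space and $M\ge0$. For $b\in K$ and real $t$ near $0$, let $U(t,b)=(U_1(t,b),\dots,U_d(t,b))$ be random vectors on this space such that, uniformly for $b=(b_1,\dots,b_d)\in K$ and $1\le j\le d$, $$U_j(t,b)=tb_jX+\frac{t^2b_j^2}{2}Y+\frac{t^3b_j^3}{6}Z+\frac{t^4b_j^4}{24}W+R_j(t,b),\qquad |R_j(t,b)|\le C_K|t|^5M,$$ with $C_K$ a deterministic constant depending only on $K$. Define random vectors in $\mathbb R^d$ $$v_1=(b_jX)_j,\quad v_2=(b_j^2Y/2)_j,\quad v_3=(b_j^3Z/6)_j,\quad v_4=(b_j^4W/24)_j.$$ Then, uniformly for $b\in K$ as $t\to0$, $$\begin{aligned} \mathbb EF(U(t,b))={}&F(0)+t\,\mathbb E\,DF(0)[v_1]\\ &+t^2\,\mathbb E\left\{DF(0)[v_2]+\tfrac12D^2F(0)[v_1,v_1]\right\}\\ &+t^3\,\mathbb E\left\{DF(0)[v_3]+D^2F(0)[v_1,v_2]+\tfrac16D^3F(0)[v_1,v_1,v_1]\right\}\\ &+t^4\,\mathbb E\Big\{DF(0)[v_4]+D^2F(0)[v_1,v_3]+\tfrac12D^2F(0)[v_2,v_2]\\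 &\qquad\quad+\tfrac12D^3F(0)[v_1,v_1,v_2]+\tfrac1{24}D^4F(0)[v_1,v_1,v_1,v_1]\Big\}+o(t^4), \end{aligned}$$ and every expectation in this formula is absolutely integrable.
   Context: $D^rF(0)[w_1,\dots,w_r]$ denotes the $r$-th Fréchet derivative of $F$ at $0$, a symmetric $r$-linear form, evaluated at $w_1,\dots,w_r\in\mathbb R^d$. ''Real $t$ near $0$'' means all real $t$ with $|t|$ at most some deterministic positive constant, the same for all $b\in K$. *)

(* Defs.v *)
From mathcomp Require Export all_boot all_order all_algebra.
From mathcomp Require Export all_classical all_reals all_analysis.
Export Order.TTheory GRing.Theory Num.Theory.
Export numFieldNormedType.Exports.

Set Implicit Arguments.
Unset Strict Implicit.
Unset Printing Implicit Defensive.

#[export] Set Implicit Arguments.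
#[export] Unset Strict Implicit.
#[export] Unset Printing Implicit Defensive.

#[global] Open Scope classical_set_scope.
#[global] Open Scope ring_scope.

(* R^d is the normed space of row vectors (with the sup norm) and carries its
   Borel sigma-algebra. *)
Notation borel_rV R d := (g_sigma_algebraType (@open 'rV[R]_d)).

Section frechet.
Context {R : realType} {V : normedModType R}.
Implicit Types (F : V -> R) (x : V) (w : seq V).

(* frechetD F x [:: w_1; ...; w_r] is D^r F(x)[w_1, ..., w_r], with the
   convention D^(r+1) F(x)[h, w_1, ..., w_r] = (D(D^r F)(x)[h])[w_1, ..., w_r].
   Evaluation at (w_1, ..., w_r) is linear and continuous, so it may be applied
   before differentiating.  The value is meaningful only where the derivatives
   exist in the sense of Ck_on below. *)
Fixpoint frechetD F x w {struct w} : R :=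
  if w is h :: w' then 'd (fun y => frechetD F y w') x h else F x.

(* The operator norm of the r-linear form L is at most c. *)
Definition opnorm_le (r : nat) (L : seq V -> R) (c : R) : Prop :=
  forall w, size w = r -> `|L w| <= c * \prod_(v <- w) `|v|.

(* F is C^k on A: for r < k, the map x |-> D^r F(x) into the r-linear forms
   with the operator norm is Frechet differentiable with derivative D^(r+1) F,
   and x |-> D^k F(x) is continuous. *)
Definition Ck_on (k : nat) F (A : set V) : Prop :=
  (forall r x, (r < k)%N -> A x -> forall e : R, 0 < e ->
     \forall h \near (0 : V),
       opnorm_le r
         (fun w => frechetD F (x + h) w - frechetD F x w - frechetD F x (h :: w))
         (e * `|h|))
  /\
  (forall x, A x -> forall e : R, 0 < e ->
     \forall y \near x,
       opnorm_le k (fun w => frechetD F y w - frechetD F x w) e).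

End frechet.

(* Main.v *)
Require Import Defs.
From mathcomp Require Import ring lra measurable_realfun.

(** The differentials of F at 0 are symmetric (Schwarz) bounded multilinear
forms, and Taylor's formula F(u) = T(u) + o(|u|^4) holds at 0.  Put A = |X|,
B = |Y| + |Z| + |W| + |M|, x = |t| A and y = t^2 B, so that |U| <= k (x + y).
Where x and y are both at most a small eta, expanding T(U) multilinearly leaves
only products of weight at least 5, each at most eta (t^4 + x^4 + y^2), which
is at most eta t^4 (1 + A^4 + B^2).  Elsewhere 1 = O_eta(x^p + y^q), hence F(U)
and the terms of the expansion are O_eta(x^p + y^q) too, and this is
o(t^4) (A^p + B^q) because p > 4 and 2 q > 4.  So for small t the error is at
most eps t^4 (1 + A^p + B^q), uniformly in b, and it remains to integrate. *)

(** * Frechet differentials *)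

(** The truncation is forced by the moments. Expanding D^4 F(0)[U,U,U,U] everywhere would produce
    terms of size t^8 Y^4, which need not be integrable when 3 < q < 4, and Taylor's formula says
    nothing away from 0. So the algebra is done pointwise, in the region where x and y are small.
    There x has weight 1 and y weight 2: t^4 + x^4 + y^2 collects the pure powers of weight 4, hence
    controls every monomial of weight 4, and any excess weight is a factor at most eta. The
    parameter b enters only through bounds |v_i| <= k A or k B with one k for all of K, which is
    where uniformity comes from. Since [frechetD] iterates differentials of scalar functions,
    linearity in the inner slots and symmetry are not built in and must be proved. *)

Section frechet_derivatives.
Context {R : realType} {V : normedModType R}.
Implicit Types (F G : V -> R) (x h : V) (w : seq V).

(** Evaluate the operator-norm estimate at the increment [s *: h] and the slots [w], then divide by
    [s]. This reduces the later arguments to one-variable calculus along lines. *)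
Lemma is_derive_frechetD k F (A : set V) r x h w :
  Ck_on k F A -> (r < k)%N -> size w = r -> A x ->
  is_derive x h (fun y => frechetD F y w) (frechetD F x (h :: w)).
Proof.
move=> [FC _] rk sw Ax.
suff C : s^-1 *: (frechetD F (s *: h + x) w - frechetD F x w) @[s --> 0^']
    --> frechetD F x (h :: w).
  by apply: DeriveDef; [exact: cvgP C|exact: cvg_lim C].
(* The error at increment [s *: h] is proportional to [|s| * c]; dividing [e] by [1 + c] also covers
   a vanishing direction or slot. *)
pose c := `|h| * \prod_(v <- w) `|v|.
have c0 : 0 <= c by rewrite mulr_ge0// prodr_ge0.
apply/cvgrPdist_le => e e0.
have e'0 : 0 < e / (1 + c) by rewrite divr_gt0// ltr_wpDr.
have sh0 : s *: h @[s --> (0 : R)] --> (0 : V).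
  by rewrite -[X in _ --> X](scale0r h); apply: cvgZr_tmp; exact: cvg_id.
have /sh0 H := FC r x rk Ax _ e'0.
near=> s.
have s0 : s != 0 by near: s; exact: nbhs_dnbhs_neq.
have /(_ w sw) : opnorm_le r (fun w => frechetD F (x + s *: h) w - frechetD F x w
    - frechetD F x (s *: h :: w)) (e / (1 + c) * `|s *: h|).
  by near: s; exact: nbhs_dnbhs.
(* A differential is linear by its type, so [s] comes out of the first slot. *)
rewrite /= linearZ /= normrZ => Hs.
set Fs := frechetD F (x + _) w in Hs.
rewrite [s *: h + x]addrC -/Fs distrC.
have -> : s^-1 *: (Fs - frechetD F x w) - 'd (fun y => frechetD F y w) x h =
    s^-1 * (Fs - frechetD F x w - s *: 'd (fun y => frechetD F y w) x h).
  by rewrite mulrBr -[X in _ = _ - _ * X]/(s * _) mulKf.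
rewrite normrM normfV ler_pdivrMl ?normr_gt0//.
apply: (le_trans Hs).
rewrite (_ : _ * _ * _ = `|s| * (e / (1 + c) * c)); last by rewrite /c; ring.
rewrite ler_wpM2l// mulrAC ler_pdivrMr ?ltr_wpDr//.
by rewrite ler_wpM2l ?(ltW e0)// ler_wpDl.
Unshelve. all: by end_near.
Qed.

Lemma is_derive_along_line G x h (s df : R) :
  is_derive (x + s *: h) h G df ->
  is_derive s 1 (fun s => G (x + s *: h)) df.
Proof.
case=> dG eG.
have E : (fun u : R => u^-1 *: (((fun s => G (x + s *: h)) \o shift s) (u *: 1) -
    G (x + s *: h))) =
  (fun u : R => u^-1 *: ((G \o shift (x + s *: h)) (u *: h) - G (x + s *: h))).
  apply/funext => u /=; congr (_ *: (G _ - _)).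
  by rewrite -[u *: 1]/(u * 1) mulr1 scalerDl addrCA.
by apply: DeriveDef; rewrite /derivable/derive E.
Qed.

End frechet_derivatives.

Lemma mean_value_bound (R : realType) (f f' : R -> R) (c : R) :
  (forall s : R, 0 <= s <= 1 -> is_derive s (1 : R) f (f' s)) ->
  (forall s : R, 0 <= s <= 1 -> `|f' s| <= c) ->
  forall s : R, 0 <= s <= 1 -> `|f s - f 0| <= c * s.
Proof.
move=> df bf s /andP[s0 s1].
have ds u : u \in `]0, s[ -> is_derive u (1 : R) f (f' u).
  rewrite in_itv /= => /andP[u0 us]; apply: df.
  by rewrite (ltW u0) (le_trans (ltW us)).
have cf : {within `[0, s], continuous f}.
  apply: derivable_within_continuous => u; rewrite in_itv /= => /andP[u0 us].
  by apply: (@ex_derive _ _ _ _ _ _ (f' u)); apply: df; rewrite u0 (le_trans us).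
have [u] := MVT_segment s0 ds cf.
rewrite in_itv /= => /andP[u0 us] ->; rewrite subr0 normrM (ger0_norm s0).
by rewrite ler_wpM2r// bf// u0 (le_trans us).
Qed.

(** * Multilinearity of the differentials *)

Section multilinear.
Context {R : realType} {V : normedModType R}.
Implicit Types (L : seq V -> R) (x h : V) (w : seq V).

(** Freezing the head slot follows the recursion of [frechetD], so inductions proceed one slot at a
    time. Only the values of [L] on lists of length [r] are constrained. *)
Fixpoint multilinear (r : nat) L : Prop :=
  if r is r'.+1 then
    (forall a h h' w, size w = r' ->
       L ((a *: h + h') :: w) = a * L (h :: w) + L (h' :: w)) /\
    (forall h, multilinear r' (fun w => L (h :: w)))
  else True.

Lemma multilinear_consD r L h h' w : multilinear r.+1 L -> size w = r ->
  L ((h + h') :: w) = L (h :: w) + L (h' :: w).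
Proof. by move=> [lin _] sw; rewrite -[h in LHS]scale1r lin// mul1r. Qed.

Lemma multilinear_consZ r L a h w : multilinear r.+1 L -> size w = r ->
  L ((a *: h) :: w) = a * L (h :: w).
Proof.
move=> mL sw; have L0 : L (0 :: w) = 0.
  by apply: (addrI (L (0 :: w))); rewrite -(multilinear_consD _ _ mL)// !addr0.
by rewrite -[a *: h]addr0 mL.1// L0 addr0.
Qed.

Lemma is_derive_eq_unique (f : V -> R) x h d1 d2 :
  is_derive x h f d1 -> is_derive x h f d2 -> d1 = d2.
Proof. by move=> [_ <-] [_ <-]. Qed.

(** An identity that is linear in [L y] and holds for all y near x may be differentiated at x;
    uniqueness of the derivative passes it on to [L']. *)
Lemma multilinear_derive r (L : V -> seq V -> R) (L' : seq V -> R) x h :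
  (\forall y \near x, multilinear r (L y)) ->
  (forall w, size w = r -> is_derive x h (fun y => L y w) (L' w)) ->
  multilinear r L'.
Proof.
elim: r L L' => [//|r IH] L L' nL dL /=; split.
- move=> a k k' w sw.
  apply: (is_derive_eq_unique (dL _ _)); first by rewrite /= sw.
  have d1 : is_derive x h (fun y => L y (k :: w)) (L' (k :: w)).
    by apply: dL; rewrite /= sw.
  have d2 : is_derive x h (fun y => L y (k' :: w)) (L' (k' :: w)).
    by apply: dL; rewrite /= sw.
  apply: near_eq_is_derive (is_deriveD (is_deriveZ a d1) d2).
  near=> y.
  have [lin _] : multilinear r.+1 (L y) by near: y; exact: nL.
  by rewrite lin.
- move=> k; apply: (IH (fun y w => L y (k :: w))).
    by apply: filterS nL => y [_ lin]; exact: lin.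
  by move=> w sw; apply: dL; rewrite /= sw.
Unshelve. all: by end_near.
Qed.

(** The first slot is linear because a differential is; the other slots inherit linearity from D^r F
    at nearby points, which is why [A] is open. *)
Lemma multilinear_frechetD k (F : V -> R) (A : set V) r x :
  open A -> Ck_on k F A -> (r <= k)%N -> A x -> multilinear r (frechetD F x).
Proof.
move=> oA FC; elim: r x => [//|r IH] x rk Ax; split => /=.
  by move=> a h h' w sw; rewrite linearD linearZ.
move=> h; apply: (@multilinear_derive r (frechetD F) _ x h).
  have : nbhs x A by exact: open_nbhs_nbhs.
  by apply: filterS => y Ay; apply: IH => //; exact: ltnW.
by move=> w sw; apply: is_derive_frechetD FC _ sw Ax.
Qed.

End multilinear.

Lemma is_derive_mulr (R : realType) (c u : R) :
  is_derive u (1 : R) (fun v => v * c) c.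
Proof.
apply: (is_derive_eq (is_deriveM (is_derive_id u (1 : R)) (is_derive_cst c u 1))).
by rewrite scaler0 add0r /GRing.scale /= mulr1.
Qed.

(** * Symmetry of the differentials *)

Section schwarz.
Context {R : realType} {V : normedModType R}.
Implicit Types (F : V -> R) (x h : V) (w : seq V).

Lemma near0_norm (Q : V -> Prop) :
  (\forall h \near 0, Q h) -> exists2 r : R, 0 < r & forall h, `|h| < r -> Q h.
Proof.
move=> /nbhs_norm0P [r r0 H]; exists r => // h hr; exact: H.
Qed.

Lemma open_shift_norm (A : set V) x : open A -> A x ->
  exists2 r : R, 0 < r & forall h, `|h| < r -> A (x + h).
Proof.
move=> oA Ax; apply: near0_norm.
have /nbhs0P : nbhs x A by exact: open_nbhs_nbhs.
by [].
Qed.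

(** Move along [s *: h] from the two base points [x + s *: h'] and [x]. The velocities are values of
    D^(r+1) F, both expanded around x by its differentiability there; their difference leaves
    D^(r+2) F(x) with outer slot [h']. *)
Lemma second_difference k F (A : set V) r x h h' w (e : R) :
  open A -> Ck_on k F A -> (r.+1 < k)%N -> size w = r -> A x -> 0 < e ->
  exists2 d : R, 0 < d & forall s : R, 0 < s < d ->
    `|frechetD F (x + s *: h + s *: h') w - frechetD F (x + s *: h) w
      - frechetD F (x + s *: h') w + frechetD F x w
      - s ^+ 2 * frechetD F x [:: h', h & w]| <= e * s ^+ 2.
Proof.
move=> oA FC rk sw Ax e0.
(* Two remainders of D^(r+1) F are incurred, each at most [e / c] times s^2 (|h| + |h'|)^2 times the
   product over [w]. *)
pose c := 1 + 2 * (`|h| + `|h'|) ^+ 2 * \prod_(v <- w) `|v|.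
have c0 : 0 < c.
  by rewrite ltr_wpDr// !mulr_ge0// prodr_ge0.
have [r1 r10 Hr1] := open_shift_norm oA Ax.
have e'0 : 0 < e / c by rewrite divr_gt0.
have [r2 r20 Hr2] := near0_norm (FC.1 _ _ rk Ax _ e'0).
(* With [s * N] below both radii, all points visited stay in [A] and in the ball where the Frechet
   estimate holds. *)
pose N := 1 + `|h| + `|h'|.
have N0 : 0 < N by rewrite /N -addrA ltr_wpDr// addr_ge0.
exists (Num.min r1 r2 / N); first by rewrite divr_gt0// lt_min r10.
move=> s /andP[s0]; rewrite ltr_pdivlMr// lt_min => /andP[sr1 sr2].
have small (u : R) (v : V) : 0 <= u <= 1 -> v = s *: h' \/ v = 0 ->
    `|u *: (s *: h) + v| <= s * (`|h| + `|h'|).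
  move=> /andP[u0 u1] Hv; rewrite mulrDr (le_trans (ler_normD _ _))// lerD//.
    rewrite !normrZ (ger0_norm u0) (gtr0_norm s0) mulrA ler_wpM2r//.
    by rewrite ler_piMl// ltW.
  case: Hv => ->; first by rewrite normrZ gtr0_norm.
  by rewrite normr0 mulr_ge0// ltW.
have smallN : s * (`|h| + `|h'|) < s * N.
  by rewrite ltr_pM2l// /N -addrA ltrDr.
(* [phi 1 - phi 0] is the quantity to be bounded; subtracting the target linearly in [u] makes the
   derivative of [phi] small. *)
pose phi (u : R) : R := frechetD F (x + s *: h' + u *: (s *: h)) w
  - frechetD F (x + u *: (s *: h)) w - u * (s ^+ 2 * frechetD F x [:: h', h & w]).
pose dphi (u : R) : R := frechetD F (x + s *: h' + u *: (s *: h)) (s *: h :: w)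
  - frechetD F (x + u *: (s *: h)) (s *: h :: w)
  - s ^+ 2 * frechetD F x [:: h', h & w].
have inA (u : R) (v : V) : 0 <= u <= 1 -> v = s *: h' \/ v = 0 ->
    A (x + (u *: (s *: h) + v)).
  by move=> u01 Hv; apply: Hr1; rewrite (le_lt_trans (small u v u01 Hv))// (lt_trans smallN).
have dG y (u : R) : A (y + u *: (s *: h)) ->
    is_derive u (1 : R) (fun u => frechetD F (y + u *: (s *: h)) w)
      (frechetD F (y + u *: (s *: h)) (s *: h :: w)).
  move=> Ay; apply: (@is_derive_along_line _ _ (frechetD F ^~ w)).
  exact: is_derive_frechetD FC (ltnW rk) sw Ay.
have dphiP (u : R) : 0 <= u <= 1 -> is_derive u (1 : R) phi (dphi u).
  move=> u01; apply: is_deriveB; first apply: is_deriveB.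
  - by apply: dG; rewrite -addrA [s *: h' + _]addrC; apply: inA => //; left.
  - by apply: dG; rewrite -[u *: _]addr0; apply: inA => //; right.
  - exact: is_derive_mulr.
have mD2 := multilinear_frechetD oA FC rk Ax.
have homD2 v : frechetD F x (v :: s *: h :: w) = s * frechetD F x (v :: h :: w).
  exact: (multilinear_consZ s h (mD2.2 v) sw).
have homD2l v v' : frechetD F x (s *: v :: v' :: w) = s * frechetD F x (v :: v' :: w).
  by apply: (multilinear_consZ _ _ mD2); rewrite /= sw.
pose B := frechetD F x [:: h', h & w].
pose p := \prod_(v <- w) `|v|.
have dphib (u : R) : 0 <= u <= 1 -> `|dphi u| <= e * s ^+ 2.
  move=> u01.
  have szw : size (s *: h :: w) = r.+1 by rewrite /= sw.
  have H1 := Hr2 (u *: (s *: h) + s *: h') _ _ szw.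
  have H2 := Hr2 (u *: (s *: h)) _ _ szw.
  have sm1 := small u _ u01 (or_introl erefl).
  have sm2 := small u _ u01 (or_intror erefl).
  rewrite addr0 in sm2.
  have {}H1 := H1 (le_lt_trans sm1 (lt_trans smallN sr2)).
  have {}H2 := H2 (le_lt_trans sm2 (lt_trans smallN sr2)).
  rewrite big_cons (normrZ s h) (gtr0_norm s0) in H1 H2.
  rewrite (multilinear_consD _ _ mD2 szw) in H1.
  rewrite /dphi -[x + s *: h' + _]addrA [s *: h' + _]addrC.
  move: H1 H2; set a1 := frechetD F (_ + (_ + _)) _; set a2 := frechetD F (x + _) _.
  set D0 := frechetD F x (s *: h :: w); set Du := frechetD F x (u *: _ :: _).
  rewrite homD2l homD2 -/p -/B => H1 H2.
  (* The increments of the two expansions differ by [s *: h']; the common part [Du] cancels. *)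
  have -> : a1 - a2 - s ^+ 2 * B =
     (a1 - D0 - (Du + s * (s * B))) - (a2 - D0 - Du).
    by move: (a1) (a2) (D0) (Du) => *; ring.
  apply: (le_trans (ler_normB _ _)); apply: (le_trans (lerD H1 H2)).
  have p0 : 0 <= p by rewrite prodr_ge0.
  have e''0 : 0 <= e / c * (s * `|h| * p).
    by rewrite mulr_ge0 ?(ltW e'0)// !mulr_ge0// ltW.
  have K1 := ler_wpM2l e''0 sm1.
  have K2 := ler_wpM2l e''0 sm2.
  rewrite ![e / c * `|_| * _]mulrAC.
  apply: (le_trans (lerD K1 K2)).
  rewrite -mulr2n -mulr_natl.
  have -> : 2 * (e / c * (s * `|h| * p) * (s * (`|h| + `|h'|))) =
     e * s ^+ 2 * ((2 * `|h| * (`|h| + `|h'|) * p) / c) by ring.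
  apply: ler_piMr; first by rewrite mulr_ge0 ?sqr_ge0 ?(ltW e0).
  rewrite ler_pdivrMr// mul1r /c -/p ler_wpDl// ler_wpM2r// -!mulrA.
  by rewrite ler_wpM2l// expr2 ler_wpM2r ?addr_ge0// lerDl.
have := mean_value_bound dphiP dphib (s := 1).
rewrite lexx ler01 => /(_ isT); rewrite mulr1; congr (`|_| <= _).
by rewrite /phi !scale0r !scale1r !addr0 mul0r subr0 mul1r [x + s *: h' + _]addrAC; ring.
Qed.

(** The second difference is symmetric in [h] and [h'], so both orders of differentiation
    approximate the same number up to an arbitrarily small multiple of s^2. *)
Lemma frechetD_swap k F (A : set V) r x h h' w :
  open A -> Ck_on k F A -> (r.+1 < k)%N -> size w = r -> A x ->
  frechetD F x [:: h, h' & w] = frechetD F x [:: h', h & w].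
Proof.
move=> oA FC rk sw Ax.
apply/eqP; rewrite -subr_eq0 -normr_le0; apply/ler_addgt0Pl => e e0; rewrite addr0.
have e20 : 0 < e / 2 by rewrite divr_gt0.
have [d1 d10 H1] := second_difference h h' oA FC rk sw Ax e20.
have [d2 d20 H2] := second_difference h' h oA FC rk sw Ax e20.
pose s := Num.min d1 d2 / 2.
have s0 : 0 < s by rewrite divr_gt0// lt_min d10.
have sm : s < Num.min d1 d2.
  by rewrite /s ltr_pdivrMr// ltr_pMr ?lt_min ?d10// ltr1n.
move: (sm); rewrite lt_min => /andP[sd1 sd2].
have {}H1 := H1 s; rewrite s0 sd1 in H1; have {}H1 := H1 isT.
have {}H2 := H2 s; rewrite s0 sd2 in H2; have {}H2 := H2 isT.
rewrite [x + s *: h' + _]addrAC in H2.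
have s20 : 0 < s ^+ 2 by rewrite exprn_gt0.
rewrite -(ler_pM2l s20) -{1}(gtr0_norm s20) -normrM.
rewrite ler_norml in H1; rewrite ler_norml in H2; rewrite ler_norml.
move: H1 H2 => /andP[? ?] /andP[? ?]; apply/andP; split; lra.
Qed.

End schwarz.

(** * Taylor's formula with small-o remainder *)

Section taylor.
Context {R : realType} {V : normedModType R}.
Implicit Types (F : V -> R) (x h u : V) (w : seq V).

(** Differentiating an identity that holds on all of [A] carries a symmetry of the inner slots past
    a new outer slot. *)
Lemma frechetD_cons_eq k F (A : set V) r x h w w' :
  open A -> Ck_on k F A -> (r < k)%N -> size w = r -> size w' = r -> A x ->
  (forall y, A y -> frechetD F y w = frechetD F y w') ->
  frechetD F x (h :: w) = frechetD F x (h :: w').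
Proof.
move=> oA FC rk sw sw' Ax eqD.
apply: is_derive_eq_unique (is_derive_frechetD h FC rk sw' Ax).
apply: near_eq_is_derive (is_derive_frechetD h FC rk sw Ax).
have : nbhs x A by exact: open_nbhs_nbhs.
by apply: filterS => y /eqD.
Qed.

Lemma taylor_lagrange_frechetD k F (A : set V) x (e : R) :
  open A -> Ck_on k F A -> A x -> 0 < e ->
  exists2 d : R, 0 < d & forall u, `|u| < d ->
    `|F (x + u) - \sum_(i < k.+1) frechetD F x (nseq i u) / i`!%:R| <= e * `|u| ^+ k.
Proof.
move=> oA FC Ax e0.
have [d1 d10 Hd1] := open_shift_norm oA Ax.
have /nbhs0P/near0_norm[d2 d20 Hd2] := FC.2 x Ax e e0.
exists (Num.min d1 d2); first by rewrite lt_min d10.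
move=> u; rewrite lt_min => /andP[ud1 ud2].
have su (s : R) (d : R) : 0 <= s <= 1 -> `|u| < d -> `|s *: u| < d.
  move=> /andP[s0 s1]; apply: le_lt_trans.
  by rewrite normrZ ger0_norm// ler_piMl.
(* The Taylor polynomial of degree [r] at 0 of s |-> D^n F(x + s u)[u, ..., u]; the derivative of
   [p n r.+1] is [p n.+1 r]. *)
pose p n r : {poly R} := \poly_(i < r.+1) (frechetD F x (nseq (n + i) u) / i`!%:R).
have pn : forall r n, (n + r = k)%N -> forall s : R, 0 <= s <= 1 ->
    `|frechetD F (x + s *: u) (nseq n u) - (p n r).[s]| <= e * `|u| ^+ k.
  (* The case r = 0 is continuity of D^k F at x. Each further step integrates over [0, s] with s <=
     1, so the bound does not grow. *)
  elim=> [|r IH] n nrk s s01.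
    rewrite addn0 in nrk; rewrite {}nrk in p *.
    have := Hd2 _ (su _ _ s01 ud2) (nseq k u); rewrite size_nseq => /(_ erefl).
    rewrite big_nseq -Monoid.iteropE /= => H.
    by rewrite horner_poly big_ord1 addn0 fact0 divr1 expr0 mulr1.
  have nk : (n < k)%N by rewrite -nrk addnS ltnS leq_addr.
  have nrk' : (n.+1 + r = k)%N by rewrite addSnnS.
  pose f (s : R) : R := frechetD F (x + s *: u) (nseq n u) - (p n r.+1).[s].
  pose f' (s : R) : R := frechetD F (x + s *: u) (nseq n.+1 u) - (p n.+1 r).[s].
  have df (s' : R) : 0 <= s' <= 1 -> is_derive s' (1 : R) f (f' s').
    move=> s'01; apply: is_deriveB.
      apply: (@is_derive_along_line _ _ (frechetD F ^~ (nseq n u))).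
      by apply: is_derive_frechetD FC nk _ _; [rewrite size_nseq|exact/Hd1/su].
    have -> : p n.+1 r = (p n r.+1)^`().
      apply/polyP => i; rewrite coef_deriv !coef_poly -[(i.+1 < r.+2)%N]/(i < r.+1)%N.
      case: ifP => _; last by rewrite mul0rn.
      rewrite addSnnS factS natrM -[RHS]mulr_natr invfM -!mulrA; congr (_ * _).
      by rewrite [X in _ * X]mulrC mulKf// pnatr_eq0.
    exact: is_derive_poly.
  have p0 : (p n r.+1).[0] = frechetD F x (nseq n u).
    by rewrite horner_coef0 coef_poly /= addn0 fact0 divr1.
  have := mean_value_bound df (IH _ nrk') s01.
  rewrite /f scale0r addr0 p0 subrr subr0 => /le_trans; apply.
  case/andP: s01 => s0 s1; apply: ler_piMr => //.
  by rewrite mulr_ge0 ?exprn_ge0// ltW.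
have := pn k 0%N (add0n k) 1; rewrite lexx ler01 scale1r => /(_ isT).
by rewrite horner_poly; under eq_bigr do rewrite expr1n mulr1 add0n.
Qed.

End taylor.

(** * Finite dimension: sup norm and boundedness of forms *)

Section row_vectors.
Context {R : realType} {d : nat}.
Implicit Types v : 'rV[R]_d.

Lemma coord_le_norm v j : `|v 0 j| <= `|v|.
Proof.
by rewrite [leRHS]/Num.norm /= mx_normrE; apply/bigmax_geP; right => /=; exists (0, j).
Qed.

Lemma norm_rV_le v (c : R) : 0 <= c -> (forall j, `|v 0 j| <= c) -> `|v| <= c.
Proof.
move=> c0 vc; rewrite [leLHS]/Num.norm /= mx_normrE (bigmax_le _ c0)// => -[i j] _.
by rewrite ord1.
Qed.

End row_vectors.

Section bounded.
Context {R : realType} {d : nat}.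
Implicit Types (L : seq 'rV[R]_d -> R).

(** Expand the first slot in the canonical basis and add the bounds of the [d] forms obtained by
    freezing a basis vector there. *)
Lemma multilinear_bounded r L :
  multilinear r L -> exists2 c : R, 0 <= c & opnorm_le r L c.
Proof.
elim: r L => [|r IH] L mL.
  exists `|L [::]| => // w /size0nil ->; by rewrite big_nil mulr1.
have /fin_all_exists2[c c0 cL] (j : 'I_d) := IH _ (mL.2 (delta_mx 0 j)).
exists (\sum_j c j); first exact: sumr_ge0.
case=> [//|h w] [sw]; rewrite big_cons.
have -> : L (h :: w) = \sum_j h 0 j * L (delta_mx 0 j :: w).
  rewrite {1}[h]row_sum_delta.
  elim/big_rec2: _ => [|j y1 y2 _ <-].
    by rewrite -(scale0r 0) (multilinear_consZ _ _ mL)// mul0r.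
  by rewrite mL.1.
apply: (le_trans (ler_norm_sum _ _ _)); rewrite mulr_suml ler_sum// => j _.
rewrite normrM mulrCA; apply: ler_pM => //; last exact: cL.
exact: coord_le_norm.
Qed.

End bounded.

(** * Formal expansion along the curve *)

Section powR_bounds.
Context {R : realType}.
Implicit Types a b r s : R.

Lemma powR_le1D a r s : 0 <= a -> 0 <= r -> r <= s -> a `^ r <= 1 + a `^ s.
Proof.
move=> a0 r0 rs; have [a1|/ltW a1] := lerP 1 a.
  by apply: (le_trans (ler_powR a1 rs)); rewrite lerDr.
apply: (@le_trans _ _ (1 `^ r)); first by rewrite ge0_ler_powR ?nnegrE.
by rewrite powR1 lerDl powR_ge0.
Qed.

Lemma expr_le1D a (n : nat) s : 0 <= a -> n%:R <= s -> a ^+ n <= 1 + a `^ s.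
Proof. by move=> a0 ns; rewrite -powR_mulrn//; exact: powR_le1D. Qed.

Lemma powR_add_le a b r : 0 <= a -> 0 <= b -> 0 <= r ->
  (a + b) `^ r <= 2 `^ r * (a `^ r + b `^ r).
Proof.
move=> a0 b0 r0.
wlog ab : a b a0 b0 / a <= b.
  move=> H; have [|/ltW] := lerP a b; first exact: H.
  by rewrite [a + b]addrC [a `^ r + _]addrC; exact: H.
apply: (@le_trans _ _ ((2 * b) `^ r)).
  by rewrite ge0_ler_powR ?nnegrE ?addr_ge0 ?mulr_ge0//; lra.
by rewrite powRM// ler_wpM2l ?powR_ge0// lerDr powR_ge0.
Qed.

Lemma powR_small s r : 0 < s -> 0 < r ->
  exists2 d, 0 < d & forall a, 0 <= a <= d -> a `^ s <= r.
Proof.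
move=> s0 r0; exists (r `^ s^-1); first exact: powR_gt0.
move=> a /andP[a0 ar]; rewrite -[leRHS]powRr1 ?(ltW r0)//.
rewrite -(mulVf (lt0r_neq0 s0)) powRrM.
by rewrite ge0_ler_powR ?nnegrE ?powR_ge0 ?(ltW s0).
Qed.

End powR_bounds.

(** * Algebra and size of the jets *)

Section jets.
Context {R : realType} {V : normedModType R}.
Variable D : seq V -> R.
Implicit Types (v h u : V).

(* The coefficients of t, ..., t^4 in the formal Taylor expansion, with
   differentials D, along the curve t v1 + t^2 v2 + t^3 v3 + t^4 v4. *)
Definition jet2 v1 v2 : R := D [:: v2] + 2^-1 * D [:: v1; v1].
Definition jet3 v1 v2 v3 : R :=
  D [:: v3] + D [:: v1; v2] + 6^-1 * D [:: v1; v1; v1].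
Definition jet4 v1 v2 v3 v4 : R :=
  D [:: v4] + D [:: v1; v3] + 2^-1 * D [:: v2; v2]
  + 2^-1 * D [:: v1; v1; v2] + 24^-1 * D [:: v1; v1; v1; v1].
Definition taylor4 u : R :=
  D [:: u] + 2^-1 * D [:: u; u] + 6^-1 * D [:: u; u; u]
  + 24^-1 * D [:: u; u; u; u].

Variable c : R.
Hypotheses (c0 : 0 <= c) (mD : forall r, (r <= 4)%N -> multilinear r D)
  (bD : forall r, (r <= 4)%N -> opnorm_le r D c).
Hypotheses (D2C : forall v h, D [:: v; h] = D [:: h; v])
  (D3C12 : forall v h u, D [:: v; h; u] = D [:: h; v; u])
  (D3C23 : forall v h u, D [:: v; h; u] = D [:: v; u; h]).

Let D1D v h : D [:: v + h] = D [:: v] + D [:: h].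
Proof. exact: (multilinear_consD _ _ (mD (isT : (1 <= 4)%N))). Qed.

Let D2Dl v h u : D [:: v + h; u] = D [:: v; u] + D [:: h; u].
Proof. exact: (multilinear_consD _ _ (mD (isT : (2 <= 4)%N))). Qed.

Let D2Dr v h u : D [:: u; v + h] = D [:: u; v] + D [:: u; h].
Proof. by rewrite !(D2C u) D2Dl. Qed.

Let D3D1 v h u u' : D [:: v + h; u; u'] = D [:: v; u; u'] + D [:: h; u; u'].
Proof. exact: (multilinear_consD _ _ (mD (isT : (3 <= 4)%N))). Qed.

Let D3D2 v h u u' : D [:: u; v + h; u'] = D [:: u; v; u'] + D [:: u; h; u'].
Proof. by rewrite !(D3C12 u) D3D1. Qed.

Let D3D3 v h u u' : D [:: u; u'; v + h] = D [:: u; u'; v] + D [:: u; u'; h].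
Proof. by rewrite !(D3C23 u u') D3D2. Qed.

Let D4 := mD (isT : (4 <= 4)%N).

Let D4D1 v h u1 u2 u3 :
  D [:: v + h; u1; u2; u3] = D [:: v; u1; u2; u3] + D [:: h; u1; u2; u3].
Proof. exact: (multilinear_consD _ _ D4). Qed.

Let D4D2 v h u1 u2 u3 :
  D [:: u1; v + h; u2; u3] = D [:: u1; v; u2; u3] + D [:: u1; h; u2; u3].
Proof. exact: (multilinear_consD _ _ (D4.2 u1)). Qed.

Let D4D3 v h u1 u2 u3 :
  D [:: u1; u2; v + h; u3] = D [:: u1; u2; v; u3] + D [:: u1; u2; h; u3].
Proof. exact: (multilinear_consD _ _ ((D4.2 u1).2 u2)). Qed.

Let D4D4 v h u1 u2 u3 :
  D [:: u1; u2; u3; v + h] = D [:: u1; u2; u3; v] + D [:: u1; u2; u3; h].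
Proof. exact: (multilinear_consD _ _ (((D4.2 u1).2 u2).2 u3)). Qed.

Let D1Z t v : D [:: t *: v] = t * D [:: v].
Proof. exact: (multilinear_consZ _ _ (mD (isT : (1 <= 4)%N))). Qed.

Let D2Zl t v u : D [:: t *: v; u] = t * D [:: v; u].
Proof. exact: (multilinear_consZ _ _ (mD (isT : (2 <= 4)%N))). Qed.

Let D2Zr t v u : D [:: u; t *: v] = t * D [:: u; v].
Proof. by rewrite !(D2C u) D2Zl. Qed.

Let D3Z1 t v u u' : D [:: t *: v; u; u'] = t * D [:: v; u; u'].
Proof. exact: (multilinear_consZ _ _ (mD (isT : (3 <= 4)%N))). Qed.

Let D3Z2 t v u u' : D [:: u; t *: v; u'] = t * D [:: u; v; u'].
Proof. by rewrite !(D3C12 u) D3Z1. Qed.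

Let D3Z3 t v u u' : D [:: u; u'; t *: v] = t * D [:: u; u'; v].
Proof. by rewrite !(D3C23 u u') D3Z2. Qed.

Let D4Z1 t v u1 u2 u3 :
  D [:: t *: v; u1; u2; u3] = t * D [:: v; u1; u2; u3].
Proof. exact: (multilinear_consZ _ _ D4). Qed.

Let D4Z2 t v u1 u2 u3 :
  D [:: u1; t *: v; u2; u3] = t * D [:: u1; v; u2; u3].
Proof. exact: (multilinear_consZ _ _ (D4.2 u1)). Qed.

Let D4Z3 t v u1 u2 u3 :
  D [:: u1; u2; t *: v; u3] = t * D [:: u1; u2; v; u3].
Proof. exact: (multilinear_consZ _ _ ((D4.2 u1).2 u2)). Qed.

Let D4Z4 t v u1 u2 u3 :
  D [:: u1; u2; u3; t *: v] = t * D [:: u1; u2; u3; v].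
Proof. exact: (multilinear_consZ _ _ (((D4.2 u1).2 u2).2 u3)). Qed.

Let bD1 v a : `|v| <= a -> `|D [:: v]| <= c * a.
Proof.
move=> va; apply: (le_trans (bD (isT : (1 <= 4)%N) (erefl : size [:: v] = 1%N))).
by rewrite big_seq1 ler_wpM2l.
Qed.

Let bD2 v1 v2 a1 a2 : `|v1| <= a1 -> `|v2| <= a2 ->
  `|D [:: v1; v2]| <= c * (a1 * a2).
Proof.
move=> h1 h2.
apply: (le_trans (bD (isT : (2 <= 4)%N) (erefl : size [:: v1; v2] = 2%N))).
by rewrite !big_cons big_nil mulr1 ler_wpM2l// ler_pM.
Qed.

Let bD3 v1 v2 v3 a1 a2 a3 : `|v1| <= a1 -> `|v2| <= a2 -> `|v3| <= a3 ->
  `|D [:: v1; v2; v3]| <= c * (a1 * a2 * a3).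
Proof.
move=> h1 h2 h3.
apply: (le_trans (bD (isT : (3 <= 4)%N) (erefl : size [:: v1; v2; v3] = 3%N))).
by rewrite !big_cons big_nil mulr1 -!mulrA ler_wpM2l// !ler_pM// mulr_ge0.
Qed.

Let bD4 v1 v2 v3 v4 a1 a2 a3 a4 :
  `|v1| <= a1 -> `|v2| <= a2 -> `|v3| <= a3 -> `|v4| <= a4 ->
  `|D [:: v1; v2; v3; v4]| <= c * (a1 * a2 * a3 * a4).
Proof.
move=> h1 h2 h3 h4.
apply: (le_trans (bD (isT : (4 <= 4)%N) (erefl : size [:: v1; v2; v3; v4] = 4%N))).
by rewrite !big_cons big_nil mulr1 -!mulrA ler_wpM2l// !ler_pM// !mulr_ge0.
Qed.

Let normDle (x y a b : R) : `|x| <= a -> `|y| <= b -> `|x + y| <= a + b.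
Proof. by move=> xa yb; apply: (le_trans (ler_normD _ _)); exact: lerD. Qed.

Let normVle (k : nat) (x a : R) : `|x| <= a -> `|k%:R^-1 * x| <= k%:R^-1 * a.
Proof. by move=> xa; rewrite normrM ger0_norm// ler_wpM2l. Qed.

(** Give [v1] weight 1, and the successive tails starting at [v2], [v3], [v4], [e] weights 2, 3, 4,
    5. Splitting a tail only where a jet term must be extracted leaves few products, all of weight
    at least 5. *)
Lemma taylor4_jets v1 v2 v3 v4 e (a n n3 n4 n5 : R) :
  `|v1| <= a -> `|v2| <= n -> `|v2 + (v3 + (v4 + e))| <= n ->
  `|v3 + (v4 + e)| <= n3 -> `|v4 + e| <= n4 -> `|e| <= n5 ->
  `|taylor4 (v1 + (v2 + (v3 + (v4 + e))))
    - (D [:: v1] + jet2 v1 v2 + jet3 v1 v2 v3 + jet4 v1 v2 v3 v4)|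
  <= c * (n5 + a * n4 + n * n3 + n3 ^+ 2 + a ^+ 2 * n3 + a * n ^+ 2 + n ^+ 3
          + n * (a + n) ^+ 3).
Proof.
move=> h1 h2 hu hu' hu'' he.
have [u'' u''E] : {u | u = v4 + e} by exists (v4 + e).
rewrite -u''E in hu'' hu' hu *.
have [u' u'E] : {u | u = v3 + u''} by exists (v3 + u'').
rewrite -u'E in hu' hu *.
have [u uE] : {u | u = v2 + u'} by exists (v2 + u').
rewrite -uE in hu *.
have [U UE] : {U | U = v1 + u} by exists (v1 + u).
rewrite -UE.
have a0 := le_trans (normr_ge0 _) h1.
have n0 := le_trans (normr_ge0 _) hu.
have hU : `|U| <= a + n by rewrite UE; apply: (le_trans (ler_normD _ _)); exact: lerD.
have E1 : D [:: U] - (D [:: v1] + D [:: v2] + D [:: v3] + D [:: v4]) = D [:: e].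
  by rewrite UE D1D uE D1D u'E D1D u''E D1D; ring.
have E2 : 2^-1 * D [:: U; U] - (2^-1 * D [:: v1; v1] + D [:: v1; v2]
    + D [:: v1; v3] + 2^-1 * D [:: v2; v2])
    = D [:: v1; u''] + D [:: v2; u'] + 2^-1 * D [:: u'; u'].
  have -> : D [:: v1; u''] = D [:: v1; u'] - D [:: v1; v3].
    by rewrite u'E D2Dr; ring.
  rewrite UE uE !(D2Dl, D2Dr) (D2C v2 v1) (D2C u' v1) (D2C u' v2).
  by field.
have E3 : 6^-1 * D [:: U; U; U] - (6^-1 * D [:: v1; v1; v1]
    + 2^-1 * D [:: v1; v1; v2]) = 2^-1 * D [:: v1; v1; u']
    + 2^-1 * D [:: v1; u; u] + 6^-1 * D [:: u; u; u].
  have -> : D [:: v1; v1; u'] = D [:: v1; v1; u] - D [:: v1; v1; v2].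
    by rewrite uE D3D3; ring.
  rewrite UE !(D3D1, D3D2, D3D3) (D3C12 u v1 v1) (D3C12 u v1 u).
  by rewrite (D3C23 v1 u v1) (D3C23 u u v1) (D3C12 u v1 u); field.
(* Only D[v1,v1,v1,v1] has weight 4 here, so replacing U by v1 one slot at a time is enough. *)
have E4 : D [:: U; U; U; U] - D [:: v1; v1; v1; v1] = D [:: u; U; U; U]
    + D [:: v1; u; U; U] + D [:: v1; v1; u; U] + D [:: v1; v1; v1; u].
  rewrite [X in X - _](_ : _ = D [:: v1; U; U; U] + D [:: u; U; U; U]); last first.
    by rewrite {1}UE D4D1.
  have -> : D [:: v1; U; U; U] = D [:: v1; v1; U; U] + D [:: v1; u; U; U].
    by rewrite {1}UE D4D2.
  have -> : D [:: v1; v1; U; U] = D [:: v1; v1; v1; U] + D [:: v1; v1; u; U].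
    by rewrite {1}UE D4D3.
  have -> : D [:: v1; v1; v1; U] = D [:: v1; v1; v1; v1] + D [:: v1; v1; v1; u].
    by rewrite {1}UE D4D4.
  by ring.
pose X1 := D [:: e].
pose X2 := D [:: v1; u''] + D [:: v2; u'] + 2^-1 * D [:: u'; u'].
pose X3 := 2^-1 * D [:: v1; v1; u'] + 2^-1 * D [:: v1; u; u] + 6^-1 * D [:: u; u; u].
pose X4 := 24^-1 * (D [:: u; U; U; U]
    + D [:: v1; u; U; U] + D [:: v1; v1; u; U] + D [:: v1; v1; v1; u]).
have -> : taylor4 U - (D [:: v1] + jet2 v1 v2 + jet3 v1 v2 v3 + jet4 v1 v2 v3 v4)
    = X1 + X2 + X3 + X4.
  by rewrite /X1 /X2 /X3 /X4 -E1 -E2 -E3 -E4 /taylor4 /jet2 /jet3 /jet4; ring.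
have B1 := bD1 he.
have B2 := normDle (normDle (bD2 h1 hu'') (bD2 h2 hu'))
  (normVle 2 (bD2 hu' hu')).
have B3 := normDle (normDle (normVle 2 (bD3 h1 h1 hu'))
  (normVle 2 (bD3 h1 hu hu))) (normVle 6 (bD3 hu hu hu)).
(* This coarser bound gives all four telescoped terms the common size n (a + n)^3. *)
have h1' : `|v1| <= a + n by rewrite (le_trans h1)// lerDl.
have B4 := normVle 24 (normDle (normDle (normDle
  (bD4 hu hU hU hU) (bD4 h1' hu hU hU)) (bD4 h1' h1' hu hU)) (bD4 h1' h1' h1' hu)).
apply: (le_trans (normDle (normDle (normDle B1 B2) B3) B4)).
have n30 := le_trans (normr_ge0 _) hu'.
have p1 : 0 <= c * n3 ^+ 2 by rewrite mulr_ge0// sqr_ge0.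
have p2 : 0 <= c * (a ^+ 2 * n3) by rewrite !mulr_ge0.
have p3 : 0 <= c * (a * n ^+ 2) by rewrite !mulr_ge0 ?sqr_ge0.
have p4 : 0 <= c * n ^+ 3 by rewrite !mulr_ge0 ?exprn_ge0.
have p5 : 0 <= c * (n * (a + n) ^+ 3) by rewrite !mulr_ge0 ?exprn_ge0 ?addr_ge0.
lra.
Qed.

Lemma jets_bound v1 v2 v3 v4 (a n : R) : 0 <= n ->
  `|v1| <= a -> `|v2| <= n -> `|v3| <= n -> `|v4| <= n ->
  [/\ `|D [:: v1]| <= 15 * c * (1 + a ^+ 4 + n ^+ 3),
      `|jet2 v1 v2| <= 15 * c * (1 + a ^+ 4 + n ^+ 3),
      `|jet3 v1 v2 v3| <= 15 * c * (1 + a ^+ 4 + n ^+ 3)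
    & `|jet4 v1 v2 v3 v4| <= 15 * c * (1 + a ^+ 4 + n ^+ 3)].
Proof.
move=> n0 h1 h2 h3 h4; have a0 := le_trans (normr_ge0 _) h1.
(* Certificates for the comparisons of a^i n^j with 1 + a^4 + n^3: for instance [q5] gives 2 a^2 n
   <= a^4 + n^2, and [q6] gives n^2 + n <= n^3 + 1. *)
have q1 := sqr_ge0 (a ^+ 2 - 2^-1); have q2 := sqr_ge0 (a - 2^-1).
have q3 := sqr_ge0 (a * (a - 1)); have q4 := sqr_ge0 (a - n).
have q5 := sqr_ge0 (a ^+ 2 - n).
have q6 : 0 <= (n + 1) * (n - 1) ^+ 2 by rewrite mulr_ge0 ?sqr_ge0 ?addr_ge0.
have a40 : 0 <= a ^+ 4 by rewrite exprn_ge0.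
have n30 : 0 <= n ^+ 3 by rewrite exprn_ge0.
have n20 : 0 <= n ^+ 2 by rewrite exprn_ge0.
have a20 : 0 <= a ^+ 2 by rewrite exprn_ge0.
pose S : R := 1 + a ^+ 4 + n ^+ 3.
have le_cS (x y k : R) : x <= c * y -> y <= k * S -> x <= c * (k * S).
  by move=> xy yS; apply: (le_trans xy); rewrite ler_wpM2l.
have Sge0 : 0 <= S by rewrite /S; lra.
have cS0 : 0 <= c * S by rewrite mulr_ge0.
have step (k x : R) : k <= 15 -> `|x| <= c * (k * S) -> `|x| <= 15 * c * S.
  move=> k15 /le_trans; apply; rewrite mulrCA -mulrA ler_wpM2r//.
split; rewrite -/S.
- apply: (step 2); first by lra.
  by apply: le_cS (bD1 h1) _; rewrite /S; lra.
- apply: (step 3); first by lra.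
  have := normDle (bD1 h2) (normVle 2 (bD2 h1 h1)).
  rewrite [2^-1 * (c * _)]mulrCA -mulrDr => H.
  by apply: le_cS H _; rewrite /S; lra.
- apply: (step 5); first by lra.
  have := normDle (normDle (bD1 h3) (bD2 h1 h2)) (normVle 6 (bD3 h1 h1 h1)).
  rewrite [6^-1 * (c * _)]mulrCA -!mulrDr => H.
  by apply: le_cS H _; rewrite /S; lra.
- apply: (step 8); first by lra.
  have := normDle (normDle (normDle (normDle (bD1 h4) (bD2 h1 h3))
    (normVle 2 (bD2 h2 h2))) (normVle 2 (bD3 h1 h1 h2)))
    (normVle 24 (bD4 h1 h1 h1 h1)).
  rewrite [2^-1 * (c * (n * n))]mulrCA [2^-1 * (c * _)]mulrCA.
  rewrite [24^-1 * (c * _)]mulrCA -!mulrDr => H.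
  by apply: le_cS H _; rewrite /S; lra.
Qed.

(** The scaling formulas serve twice: with powers of t they give homogeneity of the jets, and with
    random scalars they show the jets to be polynomials in X, Y, Z, W. *)
Lemma jet1_scale (x : R) v : D [:: x *: v] = x * D [:: v].
Proof. exact: D1Z. Qed.

Lemma jet2_scale (x y : R) v1 v2 : jet2 (x *: v1) (y *: v2)
  = y * D [:: v2] + x ^+ 2 * (2^-1 * D [:: v1; v1]).
Proof. by rewrite /jet2 !(D1Z, D2Zl, D2Zr); ring. Qed.

Lemma jet3_scale (x y z : R) v1 v2 v3 : jet3 (x *: v1) (y *: v2) (z *: v3)
  = z * D [:: v3] + x * y * D [:: v1; v2] + x ^+ 3 * (6^-1 * D [:: v1; v1; v1]).
Proof. by rewrite /jet3 !(D1Z, D2Zl, D2Zr, D3Z1, D3Z2, D3Z3); ring. Qed.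

Lemma jet4_scale (x y z w : R) v1 v2 v3 v4 :
  jet4 (x *: v1) (y *: v2) (z *: v3) (w *: v4)
  = w * D [:: v4] + x * z * D [:: v1; v3] + y ^+ 2 * (2^-1 * D [:: v2; v2])
    + x ^+ 2 * y * (2^-1 * D [:: v1; v1; v2])
    + x ^+ 4 * (24^-1 * D [:: v1; v1; v1; v1]).
Proof.
rewrite /jet4 !(D1Z, D2Zl, D2Zr, D3Z1, D3Z2, D3Z3, D4Z1, D4Z2, D4Z3, D4Z4).
by ring.
Qed.

Lemma jet2Z t v1 v2 : jet2 (t *: v1) (t ^+ 2 *: v2) = t ^+ 2 * jet2 v1 v2.
Proof. by rewrite jet2_scale /jet2; ring. Qed.

Lemma jet3Z t v1 v2 v3 :
  jet3 (t *: v1) (t ^+ 2 *: v2) (t ^+ 3 *: v3) = t ^+ 3 * jet3 v1 v2 v3.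
Proof. by rewrite jet3_scale /jet3; ring. Qed.

Lemma jet4Z t v1 v2 v3 v4 :
  jet4 (t *: v1) (t ^+ 2 *: v2) (t ^+ 3 *: v3) (t ^+ 4 *: v4)
  = t ^+ 4 * jet4 v1 v2 v3 v4.
Proof. by rewrite jet4_scale /jet4; ring. Qed.

End jets.

(** The left side is the bound of [taylor4_jets] for a = k x, n = 4 k y, and tails 3 k T y, 2 k T^2
    y, k T^3 y. Each monomial is a factor T, x or y, at most eta, times something at most [Q]. The
    coefficients add up to 607, below 1000; those of (x + 4 y)^4 add up to 5^4 = 625. *)
Lemma mixed_monomials_le (R : realType) (k eta T x y : R) :
  let Q := T ^+ 4 + x ^+ 4 + y ^+ 2 in
  1 <= k -> 0 <= x <= eta -> 0 <= y <= eta -> 0 <= T <= eta -> eta <= 1 ->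
  k * (T ^+ 3 * y) + (k * x) * (2 * k * (T ^+ 2 * y))
    + (4 * k * y) * (3 * k * (T * y)) + (3 * k * (T * y)) ^+ 2
    + (k * x) ^+ 2 * (3 * k * (T * y)) + (k * x) * (4 * k * y) ^+ 2
    + (4 * k * y) ^+ 3 + (4 * k * y) * (k * x + 4 * k * y) ^+ 3
    <= 1000 * (k ^+ 4 * (eta * Q))
  /\ (x + 4 * y) ^+ 4 <= 625 * Q.
Proof.
move=> Q k1 /andP[x0 xe] /andP[y0 ye] /andP[T0 Te] e1.
have eta0 := le_trans x0 xe.
have T2y0 : 0 <= T ^+ 2 * y by rewrite mulr_ge0// exprn_ge0.
have x2y0 : 0 <= x ^+ 2 * y by rewrite mulr_ge0// exprn_ge0.
have [x1 [y1 T1]] := (le_trans xe e1, (le_trans ye e1, le_trans Te e1)).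
have [Q0 m1 m2 m3 m4] : [/\ 0 <= Q, T ^+ 2 * y <= Q, x ^+ 2 * y <= Q,
    y ^+ 2 <= Q & x ^+ 4 <= Q].
  have T4 : 0 <= T ^+ 4 by rewrite exprn_ge0.
  have x4 : 0 <= x ^+ 4 by rewrite exprn_ge0.
  have y2 : 0 <= y ^+ 2 by rewrite exprn_ge0.
  have s1 := sqr_ge0 (T ^+ 2 - y); have s2 := sqr_ge0 (x ^+ 2 - y).
  by rewrite /Q; split; lra.
have y20 : 0 <= y ^+ 2 by rewrite exprn_ge0.
have xy2 : x * y ^+ 2 <= Q by apply: (le_trans _ m3); rewrite ler_piMl.
have yy2 : y * y ^+ 2 <= Q by apply: (le_trans _ m3); rewrite ler_piMl.
have Ty2 : T * y ^+ 2 <= Q by apply: (le_trans _ m3); rewrite ler_piMl.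
split; last first.
  have r1 : x * (x ^+ 2 * y) <= Q by apply: (le_trans _ m2); rewrite ler_piMl.
  have r2 : x * (x * y ^+ 2) <= Q.
    by apply: (le_trans _ xy2); rewrite ler_piMl// mulr_ge0.
  have r3 : x * (y * y ^+ 2) <= Q.
    by apply: (le_trans _ yy2); rewrite ler_piMl// mulr_ge0.
  have r4 : y * (y * y ^+ 2) <= Q.
    by apply: (le_trans _ yy2); rewrite ler_piMl// mulr_ge0.
  clear -m4 r1 r2 r3 r4; move: Q m4 r1 r2 r3 r4 => Q *; lra.
have eQ0 : 0 <= eta * Q by rewrite mulr_ge0.
(* Since k >= 1, every power of k can be raised to the fourth. *)
have kk i (m : R) : (i <= 4)%N -> m <= eta * Q -> k ^+ i * m <= k ^+ 4 * (eta * Q).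
  move=> i4 mQ; apply: (@le_trans _ _ (k ^+ i * (eta * Q))).
    by rewrite ler_wpM2l// exprn_ge0// (le_trans ler01).
  by rewrite ler_wpM2r// ler_weXn2l.
pose W := k ^+ 4 * (eta * Q).
have W0 : 0 <= W by rewrite mulr_ge0// exprn_ge0// (le_trans ler01).
have K1 : k ^+ 1 * (T * (T ^+ 2 * y)) <= W by apply: kk => //; rewrite ler_pM.
have K2 : k ^+ 2 * (x * (T ^+ 2 * y)) <= W by apply: kk => //; rewrite ler_pM.
have K3 : k ^+ 2 * (T * y ^+ 2) <= W by apply: kk => //; rewrite ler_pM.
have K4 : k ^+ 2 * (T * (T * y ^+ 2)) <= W.
  by apply: kk => //; rewrite ler_pM// mulr_ge0.
have K5 : k ^+ 3 * (T * (x ^+ 2 * y)) <= W by apply: kk => //; rewrite ler_pM.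
have K6 : k ^+ 3 * (x * y ^+ 2) <= W by apply: kk => //; rewrite ler_pM.
have K7 : k ^+ 3 * (y * y ^+ 2) <= W by apply: kk => //; rewrite ler_pM.
have K8 : k ^+ 4 * (x * (x ^+ 2 * y)) <= W by apply: kk => //; rewrite ler_pM.
have K9 : k ^+ 4 * (x * (x * y ^+ 2)) <= W.
  by apply: kk => //; rewrite ler_pM// mulr_ge0.
have K10 : k ^+ 4 * (x * (y * y ^+ 2)) <= W.
  by apply: kk => //; rewrite ler_pM// mulr_ge0.
have K11 : k ^+ 4 * (y * (y * y ^+ 2)) <= W.
  by apply: kk => //; rewrite ler_pM// mulr_ge0.
clear -W0 K1 K2 K3 K4 K5 K6 K7 K8 K9 K10 K11; rewrite -/W.
move: W W0 K1 K2 K3 K4 K5 K6 K7 K8 K9 K10 K11 => W *; lra.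
Qed.

Section pointwise.
Context {R : realType} {V : normedModType R}.
Variables (F : V -> R) (D : seq V -> R) (c : R).
Hypotheses (c0 : 0 <= c) (mD : forall r, (r <= 4)%N -> multilinear r D)
  (bD : forall r, (r <= 4)%N -> opnorm_le r D c).
Hypotheses (D2C : forall v h, D [:: v; h] = D [:: h; v])
  (D3C12 : forall v h u, D [:: v; h; u] = D [:: h; v; u])
  (D3C23 : forall v h u, D [:: v; h; u] = D [:: v; u; h]).

(** The Taylor remainder contributes the 625, through |U| <= k (x + 4 y); the products of excess
    weight contribute the 1000 with the small factor eta. *)
Lemma expansion_near0 (v1 v2 v3 v4 e : V) (k eta T x y eps : R) :
  let U := v1 + (v2 + (v3 + (v4 + e))) in
  1 <= k -> 0 <= x <= eta -> 0 <= y <= eta -> 0 <= T <= eta -> eta <= 1 ->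
  0 <= eps ->
  `|v1| <= k * x -> `|v2| <= k * y -> `|v3| <= k * (T * y) ->
  `|v4| <= k * (T ^+ 2 * y) -> `|e| <= k * (T ^+ 3 * y) ->
  `|F U - (F 0 + taylor4 D U)| <= eps * `|U| ^+ 4 ->
  `|F U - (F 0 + (D [:: v1] + jet2 D v1 v2 + jet3 D v1 v2 v3
      + jet4 D v1 v2 v3 v4))|
    <= (625 * eps + 1000 * c * eta) * k ^+ 4 * (T ^+ 4 + x ^+ 4 + y ^+ 2).
Proof.
move=> U k1 xe0 ye0 Te0 e1 eps0 h1 h2 h3 h4 h5 HF.
have [/andP[x0 xe] [/andP[y0 ye] /andP[T0 Te]]] := (xe0, (ye0, Te0)).
have k0 : 0 <= k by lra.
have T1 : T <= 1 by lra.
have Ty0 : 0 <= T * y by rewrite mulr_ge0.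
have T2y0 : 0 <= T ^+ 2 * y by rewrite mulr_ge0// exprn_ge0.
have Ty1 : T * y <= y by rewrite ler_piMl.
have Ty2 : T ^+ 2 * y <= T * y by rewrite expr2 -mulrA ler_piMl.
have Ty3 : T ^+ 3 * y <= T ^+ 2 * y by rewrite exprS -mulrA ler_piMl.
have kle (a b : R) : a <= b -> k * a <= k * b by move=> ?; rewrite ler_wpM2l.
have kTy1 := kle _ _ Ty1; have kTy2 := kle _ _ Ty2; have kTy3 := kle _ _ Ty3.
have h45 : `|v4 + e| <= 2 * k * (T ^+ 2 * y).
  by apply: (le_trans (ler_normD _ _)); lra.
have h345 : `|v3 + (v4 + e)| <= 3 * k * (T * y).
  by apply: (le_trans (ler_normD _ _)); lra.
have h2345 : `|v2 + (v3 + (v4 + e))| <= 4 * k * y.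
  by apply: (le_trans (ler_normD _ _)); lra.
have h2' : `|v2| <= 4 * k * y.
  by apply: (le_trans h2); rewrite -mulrA ler_peMl ?mulr_ge0//; lra.
have HJ := taylor4_jets c0 mD bD D2C D3C12 D3C23 h1 h2' h2345 h345 h45 h5.
pose Q := T ^+ 4 + x ^+ 4 + y ^+ 2.
have [HM HM4] : _ /\ _ := mixed_monomials_le k1 xe0 ye0 Te0 e1.
have {}HJ := le_trans HJ (ler_wpM2l c0 HM).
have hU : `|U| ^+ 4 <= k ^+ 4 * (625 * Q).
  have hU : `|U| <= k * (x + 4 * y) by apply: (le_trans (ler_normD _ _)); lra.
  apply: (@le_trans _ _ ((k * (x + 4 * y)) ^+ 4)).
    by rewrite lerXn2r ?nnegrE// (le_trans _ hU).
  by rewrite exprMn ler_wpM2l ?exprn_ge0.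
have {}HF := le_trans HF (ler_wpM2l eps0 hU).
set J := (_ + _ + _ + jet4 _ _ _ _ _) in HJ *.
rewrite (_ : F U - (F 0 + J) = F U - (F 0 + taylor4 D U) + (taylor4 D U - J)); last by ring.
apply: (le_trans (ler_normD _ _)); apply: (le_trans (lerD HF HJ)).
by rewrite -/Q le_eqVlt; apply/orP; left; apply/eqP; ring.
Qed.

End pointwise.

(** * Pointwise error bounds over all of the probability space *)

Section uniform.
Context {R : realType} {V : normedModType R}.
Variables (F : V -> R) (D : seq V -> R) (c : R).
Hypotheses (c0 : 0 <= c) (mD : forall r, (r <= 4)%N -> multilinear r D)
  (bD : forall r, (r <= 4)%N -> opnorm_le r D c).
Hypotheses (D2C : forall v h, D [:: v; h] = D [:: h; v])
  (D3C12 : forall v h u, D [:: v; h; u] = D [:: h; v; u])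
  (D3C23 : forall v h u, D [:: v; h; u] = D [:: v; u; h]).
Variables (C g p q : R).
Hypotheses (g0 : 0 < g) (F_growth : forall u, `|F u| <= C * (1 + `|u| `^ g))
  (p4 : 4 < p) (pg : g < p) (q3 : 3 < q) (qg : g < q).

Let C0 : 0 <= C.
Proof.
have := le_trans (normr_ge0 _) (F_growth 0).
by rewrite normr0 powR0 ?gt_eqF// addr0 mulr1.
Qed.

Lemma growth_le u (k x y : R) : 0 <= k -> 0 <= x -> 0 <= y ->
  `|u| <= k * (x + y) ->
  `|F u| <= C * (1 + 2 * (2 * k) `^ g) * (1 + x `^ p + y `^ q).
Proof.
move=> k0 x0 y0 hu.
have xg := powR_le1D x0 (ltW g0) (ltW pg).
have yg := powR_le1D y0 (ltW g0) (ltW qg).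
have P1 : 1 <= 1 + x `^ p + y `^ q.
  by have := powR_ge0 x p; have := powR_ge0 y q; lra.
have kg := powR_ge0 (2 * k) g.
apply: (le_trans (F_growth u)); rewrite -mulrA ler_wpM2l// mulrDl mul1r lerD//.
apply: (@le_trans _ _ ((k * (x + y)) `^ g)).
  by rewrite ge0_ler_powR ?nnegrE ?(ltW g0)// (le_trans _ hu).
rewrite powRM ?addr_ge0//.
apply: (le_trans (ler_wpM2l (powR_ge0 _ _) (powR_add_le x0 y0 (ltW g0)))).
rewrite mulrA [_ `^ g * _]mulrC -powRM// -mulrA mulrCA ler_wpM2l//.
by have := powR_ge0 x p; have := powR_ge0 y q; lra.
Qed.

Lemma jets_le v1 v2 v3 v4 (k x y : R) : 1 <= k -> 0 <= x -> 0 <= y ->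
  `|v1| <= k * x -> `|v2| <= k * y -> `|v3| <= k * y -> `|v4| <= k * y ->
  let B := 45 * c * k ^+ 4 * (1 + x `^ p + y `^ q) in
  [/\ `|D [:: v1]| <= B, `|jet2 D v1 v2| <= B, `|jet3 D v1 v2 v3| <= B
    & `|jet4 D v1 v2 v3 v4| <= B].
Proof.
move=> k1 x0 y0 h1 h2 h3 h4 B.
have k0 : 0 <= k := le_trans ler01 k1.
have ky0 : 0 <= k * y by rewrite mulr_ge0.
suff H : 15 * c * (1 + (k * x) ^+ 4 + (k * y) ^+ 3) <= B.
  by have [b1 b2 b3 b4] := jets_bound c0 bD ky0 h1 h2 h3 h4;
    split; apply: (le_trans _ H).
(* 1 + x^4 + y^3 is at most 3 + x^p + y^q, which turns 15 into 45. *)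
have -> : B = 15 * c * (k ^+ 4 * (3 * (1 + x `^ p + y `^ q))) by rewrite /B; ring.
rewrite ler_wpM2l ?mulr_ge0// !exprMn.
have xp : x ^+ 4 <= 1 + x `^ p by apply: expr_le1D => //; exact: ltW.
have yq : y ^+ 3 <= 1 + y `^ q by apply: expr_le1D => //; exact: ltW.
have k41 : 1 <= k ^+ 4 by rewrite exprn_ege1.
have k34 : k ^+ 3 <= k ^+ 4 by rewrite ler_weXn2l.
have y3 : k ^+ 3 * y ^+ 3 <= k ^+ 4 * y ^+ 3 by rewrite ler_wpM2r// exprn_ge0.
have k40 : 0 <= k ^+ 4 by rewrite exprn_ge0.
apply: (@le_trans _ _ (k ^+ 4 * (1 + x ^+ 4 + y ^+ 3))); first by lra.
rewrite ler_wpM2l//.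
by have := powR_ge0 x p; have := powR_ge0 y q; lra.
Qed.

(** A triangle inequality without cancellation: C is paid once more for F(0), and 180 is 45 for each
    of the four jets. It becomes small only later, where x or y exceeds eta. *)
Lemma expansion_away_le v1 v2 v3 v4 u (k x y : R) :
  1 <= k -> 0 <= x -> 0 <= y -> `|u| <= 4 * k * (x + y) ->
  `|v1| <= k * x -> `|v2| <= k * y -> `|v3| <= k * y -> `|v4| <= k * y ->
  `|F u - (F 0 + (D [:: v1] + jet2 D v1 v2 + jet3 D v1 v2 v3
      + jet4 D v1 v2 v3 v4))|
  <= (C * (2 + 2 * (2 * (4 * k)) `^ g) + 180 * c * k ^+ 4)
     * (1 + x `^ p + y `^ q).
Proof.
move=> k1 x0 y0 hu h1 h2 h3 h4.
have k0 : 0 <= 4 * k by lra.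
have HF := growth_le k0 x0 y0 hu.
have [b1 b2 b3 b4] := jets_le k1 x0 y0 h1 h2 h3 h4.
have HF0 : `|F 0| <= C * (1 + x `^ p + y `^ q).
  apply: (le_trans (F_growth 0)); rewrite normr0 powR0 ?gt_eqF// addr0 ler_wpM2l//.
  by have := powR_ge0 x p; have := powR_ge0 y q; lra.
apply: (le_trans (ler_normB _ _)); apply: (le_trans (lerD HF (ler_normD _ _))).
have HJ : `|D [:: v1] + jet2 D v1 v2 + jet3 D v1 v2 v3 + jet4 D v1 v2 v3 v4|
    <= 4 * (45 * c * k ^+ 4 * (1 + x `^ p + y `^ q)).
  apply: (le_trans (ler_normD _ _)).
  apply: (le_trans (lerD (ler_normD _ _) b4)).
  apply: (le_trans (lerD (lerD (ler_normD _ _) b3) (lexx _))).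
  by move: b1 b2; move: (45 * _ * _ * _) => b b1 b2; lra.
apply: (le_trans (lerD (lexx _) (lerD HF0 HJ))).
by rewrite le_eqVlt; apply/orP; left; apply/eqP; ring.
Qed.

Hypothesis F_taylor : forall e : R, 0 < e -> exists2 d : R, 0 < d &
  forall u, `|u| < d -> `|F u - (F 0 + taylor4 D u)| <= e * `|u| ^+ 4.

Lemma uniform_expansion (k eps : R) : 1 <= k -> 0 < eps ->
  exists2 d : R, 0 < d & forall t (a b : R) v1 v2 v3 v4 e,
    `|t| <= d -> 0 <= a -> 0 <= b ->
    `|v1| <= k * a -> `|v2| <= k * b -> `|v3| <= k * b -> `|v4| <= k * b ->
    `|e| <= k * `|t| ^+ 5 * b ->
    `|F (t *: v1 + (t ^+ 2 *: v2 + (t ^+ 3 *: v3 + (t ^+ 4 *: v4 + e))))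
      - (F 0 + t * D [:: v1] + t ^+ 2 * jet2 D v1 v2
         + t ^+ 3 * jet3 D v1 v2 v3 + t ^+ 4 * jet4 D v1 v2 v3 v4)|
    <= eps * t ^+ 4 * (1 + a `^ p + b `^ q).
Proof.
move=> k1 eps0.
have k0 : 0 < k := lt_le_trans ltr01 k1.
have k40 : 0 < k ^+ 4 by rewrite exprn_gt0.
(* Left visible, the unary numeral 1000 would be normalised by [//]. *)
have [m mE] : {m : R | m = 1000} by exists 1000.
have m0 : 0 < m by rewrite mE ltr0n.
(* The near region may spend eps / 3, as 1 + a^4 + b^2 is at most 3 (1 + a^p + b^q). Half of it goes
   to the Taylor remainder through [e'], half to the excess products through eta. *)
pose e' := eps / (6 * m * k ^+ 4).
have e'0 : 0 < e' by rewrite divr_gt0// !mulr_gt0.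
have [r r0 HT] := F_taylor e'0.
have c10 : 0 < c + 1 by rewrite ltr_wpDl.
(* In the near region |U| <= 5 k eta < 6 k eta <= r, so Taylor's formula applies; [c + 1] avoids a
   zero divisor. *)
have [eta [eta0 eta1 etar etae]] : exists eta, [/\ 0 < eta, eta <= 1,
    eta * (6 * k) <= r & eta * (6 * m * (c + 1) * k ^+ 4) <= eps].
  exists (Num.min 1 (Num.min (r / (6 * k)) (eps / (6 * m * (c + 1) * k ^+ 4)))).
  split; first by rewrite !lt_min ltr01 !divr_gt0// !mulr_gt0.
  - by rewrite ge_min lexx.
  - by rewrite -ler_pdivlMr ?mulr_gt0// !ge_min lexx orbT.
  - by rewrite -ler_pdivlMr ?mulr_gt0// !ge_min lexx !orbT.
have G0' : 0 <= C * (2 + 2 * (2 * (4 * k)) `^ g) + 180 * c * k ^+ 4.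
  apply: addr_ge0; last exact: mulr_ge0 (mulr_ge0 (ler0n _ _) c0) (ltW k40).
  by apply: mulr_ge0 C0 _; apply: addr_ge0 => //; rewrite mulr_ge0// powR_ge0.
pose G := C * (2 + 2 * (2 * (4 * k)) `^ g) + 180 * c * k ^+ 4 + 1.
have G0 : 0 < G by exact: ltr_wpDl G0' ltr01.
(* If x or y exceeds eta, then 1 <= (x / eta)^p + (y / eta)^q, and [H] absorbs the constant 1 into
   x^p + y^q. *)
pose H := 1 + eta^-1 `^ p + eta^-1 `^ q.
have H0 : 0 < H.
  by have := powR_ge0 eta^-1 p; have := powR_ge0 eta^-1 q; rewrite /H; lra.
have rho0 : 0 < eps / (G * H) by rewrite divr_gt0// mulr_gt0.
have p40 : 0 < p - 4 by rewrite subr_gt0.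
have q20 : 0 < q - 2 by rewrite subr_gt0 (lt_trans _ q3)// ltr_nat.
(* Here x^p = T^4 T^(p-4) a^p and y^q = T^4 (T^2)^(q-2) b^q, so small t makes both at most T^4 eps /
   (G H) times the moment. *)
have [d1 d10 Hd1] := powR_small p40 rho0.
have [d2 d20 Hd2] := powR_small q20 rho0.
exists (Num.min eta (Num.min d1 d2)); first by rewrite !lt_min eta0 d10.
move=> t a b v1 v2 v3 v4 e; rewrite !le_min => /and3P[teta td1 td2] a0 b0 h1 h2 h3 h4 he.
have [T TE] : {T | T = `|t|} by exists `|t|.
rewrite -TE in teta td1 td2 he.
have T0 : 0 <= T by rewrite TE.
have TXE i : `|t ^+ i| = T ^+ i by rewrite normrX TE.
have T4E : t ^+ 4 = T ^+ 4.
  by rewrite -TXE ger0_norm// -[4%N]/(2 * 2)%N exprM sqr_ge0.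
have T1 : T <= 1 := le_trans teta eta1.
pose x := T * a; pose y := T ^+ 2 * b.
have x0 : 0 <= x by rewrite mulr_ge0.
have y0 : 0 <= y by rewrite mulr_ge0// exprn_ge0.
have hv i (v : V) s : `|v| <= k * s -> `|t ^+ i *: v| <= k * (T ^+ i * s).
  by move=> vs; rewrite normrZ TXE mulrCA ler_wpM2l// exprn_ge0.
have hV1 : `|t *: v1| <= k * x by have := hv 1%N _ _ h1; rewrite !expr1.
have hV2 : `|t ^+ 2 *: v2| <= k * y by exact: hv.
have hV3 : `|t ^+ 3 *: v3| <= k * (T * y).
  have -> : T * y = T ^+ 3 * b by rewrite /y; ring.
  exact: hv.
have hV4 : `|t ^+ 4 *: v4| <= k * (T ^+ 2 * y).
  have -> : T ^+ 2 * y = T ^+ 4 * b by rewrite /y; ring.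
  exact: hv.
have hE : `|e| <= k * (T ^+ 3 * y).
  by have -> : k * (T ^+ 3 * y) = k * T ^+ 5 * b by rewrite /y; ring.
have Ty1 : T * y <= y by rewrite ler_piMl.
have Ty2 : T ^+ 2 * y <= y by rewrite ler_piMl// exprn_ile1.
have Ty3 : T ^+ 3 * y <= y by rewrite ler_piMl// exprn_ile1.
have le_k z : z <= y -> k * z <= k * y by move=> zy; rewrite ler_wpM2l// ltW.
have {}hV3' := le_trans hV3 (le_k _ Ty1).
have {}hV4' := le_trans hV4 (le_k _ Ty2).
have {}hE' := le_trans hE (le_k _ Ty3).
(* Homogeneity moves the powers of t inside, so that the pointwise lemmas apply to the scaled
   vectors. *)
rewrite -(jet2Z mD D2C) -(jet3Z mD D2C D3C12 D3C23) -(jet4Z mD D2C D3C12 D3C23).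
rewrite -(multilinear_consZ t v1 (mD (isT : (1 <= 4)%N)) (erefl : size [::] = 0%N)).
set V1 := t *: v1 in hV1 *; set V2 := t ^+ 2 *: v2 in hV2 *.
set V3 := t ^+ 3 *: v3 in hV3 hV3' *; set V4 := t ^+ 4 *: v4 in hV4 hV4' *.
set U := V1 + _.
have hU : `|U| <= k * x + 4 * (k * y).
  apply: (le_trans (ler_normD _ _)); apply: lerD => //.
  apply: (le_trans (ler_normD _ _)); apply: (le_trans (lerD hV2 (ler_normD _ _))).
  apply: (le_trans (lerD (lexx _) (lerD hV3' (ler_normD _ _)))).
  apply: (le_trans (lerD (lexx _) (lerD (lexx _) (lerD hV4' hE')))).
  by rewrite le_eqVlt; apply/orP; left; apply/eqP; ring.
rewrite (_ : F 0 + _ + _ + _ + _ = F 0 + (D [:: V1] + jet2 D V1 V2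
  + jet3 D V1 V2 V3 + jet4 D V1 V2 V3 V4)); last by rewrite !addrA.
have ap0 := powR_ge0 a p; have bq0 := powR_ge0 b q.
have [/andP[xe ye]|far] := boolP ((x <= eta) && (y <= eta)).
- have kx : k * x <= k * eta by rewrite ler_wpM2l// ltW.
  have ky : k * y <= k * eta by rewrite ler_wpM2l// ltW.
  have ke : 0 < k * eta by rewrite mulr_gt0.
  have Ur : `|U| < r by lra.
  have x01 : 0 <= x <= eta by rewrite x0.
  have y01 : 0 <= y <= eta by rewrite y0.
  have T01 : 0 <= T <= eta by rewrite T0.
  have := expansion_near0 c0 mD bD D2C D3C12 D3C23 k1 x01 y01 T01 eta1 (ltW e'0)
    hV1 hV2 hV3 hV4 hE (HT _ Ur).
  move=> /le_trans; apply; rewrite T4E.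
  have -> : T ^+ 4 + x ^+ 4 + y ^+ 2 = T ^+ 4 * (1 + a ^+ 4 + b ^+ 2).
    by rewrite /x /y; ring.
  have ap : a ^+ 4 <= 1 + a `^ p by apply: expr_le1D => //; exact: ltW.
  have bq : b ^+ 2 <= 1 + b `^ q.
    by apply: expr_le1D => //; rewrite (le_trans _ (ltW q3))// ler_nat.
  have Q3 : 1 + a ^+ 4 + b ^+ 2 <= 3 * (1 + a `^ p + b `^ q) by lra.
  have T40 : 0 <= T ^+ 4 by rewrite exprn_ge0.
  have e'k : e' * (6 * m * k ^+ 4) = eps.
    by rewrite /e' divfK// gt_eqF// !mulr_gt0.
  have ek : (625 * e' + 1000 * c * eta) * k ^+ 4 <= eps / 3.
    have : 0 <= e' * k ^+ 4 by rewrite mulr_ge0// ltW.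
    have : 0 <= eta * k ^+ 4 by rewrite mulr_ge0// ltW.
    by move: e'k etae; rewrite mE; lra.
  apply: (le_trans (ler_wpM2r _ ek)); first by rewrite mulr_ge0// !addr_ge0// exprn_ge0.
  rewrite -[eps * _ * _]mulrA mulrCA [leRHS]mulrCA ler_wpM2l//.
  by apply: (le_trans (ler_wpM2l _ Q3)); [rewrite divr_ge0// ltW|lra].
- have Pxy : 1 + x `^ p + y `^ q <= H * (x `^ p + y `^ q).
    have one (z r' : R) : 0 <= z -> 1 < z / eta -> 0 <= r' -> 1 <= eta^-1 `^ r' * z `^ r'.
      move=> z0 z1 r'0; rewrite -powRM// ?invr_ge0 ?(ltW eta0)// mulrC.
      apply: (@le_trans _ _ (1 `^ r')); first by rewrite powR1.
      by rewrite ge0_ler_powR ?nnegrE ?(ltW z1)// divr_ge0// ltW.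
    have xp0 := powR_ge0 x p; have yq0 := powR_ge0 y q.
    have ep0 := powR_ge0 eta^-1 p; have eq0 := powR_ge0 eta^-1 q.
    have epx := mulr_ge0 ep0 yq0; have eqx := mulr_ge0 eq0 xp0.
    have epy := mulr_ge0 ep0 xp0; have eqy := mulr_ge0 eq0 yq0.
    have : 1 <= eta^-1 `^ p * x `^ p + eta^-1 `^ q * y `^ q.
      move: far; rewrite negb_and -!ltNge => /orP[] h.
        apply: ler_wpDr => //; apply: one => //; first by rewrite ltr_pdivlMr// mul1r.
        by rewrite (le_trans _ (ltW p4)).
      apply: ler_wpDl => //; apply: one => //; first by rewrite ltr_pdivlMr// mul1r.
      by rewrite (le_trans _ (ltW q3)).
    by rewrite /H; lra.
  have xp : x `^ p <= T ^+ 4 * (eps / (G * H)) * a `^ p.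
    rewrite powRM// ler_wpM2r//.
    rewrite -[in leLHS](subrK 4 p) addrC powRD; last first.
      by rewrite addrC subrK gt_eqF// (lt_trans _ p4).
    by rewrite powR_mulrn// ler_wpM2l ?exprn_ge0// Hd1// T0.
  have yq : y `^ q <= T ^+ 4 * (eps / (G * H)) * b `^ q.
    have T20 : 0 <= T ^+ 2 by rewrite exprn_ge0.
    rewrite powRM// ler_wpM2r//.
    rewrite -[in leLHS](subrK 2 q) addrC powRD; last first.
      by rewrite addrC subrK gt_eqF// (lt_trans _ q3).
    rewrite powR_mulrn// -exprM ler_wpM2l ?exprn_ge0// Hd2// T20/=.
    by rewrite (le_trans _ td2)// expr2 ler_piMl.
  have hU' : `|U| <= 4 * k * (x + y).
    have kx0 : 0 <= k * x by rewrite mulr_ge0// ltW.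
    by apply: (le_trans hU); lra.
  apply: (le_trans (expansion_away_le k1 x0 y0 hU' hV1 hV2 hV3' hV4')).
  have GH0 : 0 <= G * H by rewrite mulr_ge0// ltW.
  apply: (@le_trans _ _ (G * (H * (x `^ p + y `^ q)))).
    apply: ler_pM => //; last by rewrite lerDl.
    by rewrite !addr_ge0// powR_ge0.
  rewrite mulrA; apply: (le_trans (ler_wpM2l GH0 (lerD xp yq))).
  rewrite -mulrDr mulrA [G * H * _]mulrCA [G * H * _]mulrC.
  rewrite divfK ?gt_eqF ?mulr_gt0// T4E [eps * _]mulrC ler_wpM2l//.
    by rewrite mulr_ge0 ?exprn_ge0// ltW.
  by rewrite -addrA lerDr.
Qed.

End uniform.

(** * Integration *)

Section integration.
Context {R : realType} {disp : measure_display} {T : measurableType disp}.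
Variable P : probability T R.
Implicit Types f g h : T -> R.
Local Notation integ f := (P.-integrable [set: T] (EFin \o f)).

Lemma integ_cst (k : R) : integ (fun=> k).
Proof. exact: finite_measure_integrable_cst. Qed.

Lemma integ_add f g : integ f -> integ g -> integ (fun x => f x + g x).
Proof. by move=> fi gi; exact: eq_integrable (integrableD _ fi gi). Qed.

Lemma integ_sub f g : integ f -> integ g -> integ (fun x => f x - g x).
Proof. by move=> fi gi; exact: eq_integrable (integrableB _ fi gi). Qed.

Lemma integ_scale (k : R) f : integ f -> integ (fun x => k * f x).
Proof. by move=> fi; exact: eq_integrable (integrableZl _ k fi). Qed.

Lemma integ_le f g : measurable_fun setT f -> (forall x, `|f x| <= g x) ->
  integ g -> integ f.
Proof.
move=> mf fg; apply: le_integrable => //; first exact/measurable_EFinP.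
by move=> x _ /=; rewrite lee_fin (le_trans (fg x)) ?ler_norm.
Qed.

Lemma ae_normr_integral_le f g : measurable_fun setT f -> integ g ->
  (forall x, 0 <= g x) -> {ae P, forall x, `|f x| <= g x} ->
  (\int[P]_x `|f x|%:E <= \int[P]_x (g x)%:E)%E.
Proof.
move=> mf gi g0 fg; apply: ae_ge0_le_integral => //.
- by apply/measurable_EFinP; exact: measurableT_comp.
- by move=> x _; rewrite lee_fin.
- by case/integrableP : gi.
- by apply: filterS fg => x fgx _; rewrite lee_fin.
Qed.

(** Domination is available only almost everywhere, because the expansion of U holds almost surely
    for each t and b. *)
Lemma integ_ae_le f g : measurable_fun setT f -> integ g ->
  (forall x, 0 <= g x) -> {ae P, forall x, `|f x| <= g x} -> integ f.
Proof.
move=> mf gi g0 fg; apply/integrableP; split; first exact/measurable_EFinP.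
apply: (le_lt_trans (ae_normr_integral_le mf gi g0 fg)).
have /integrableP[_] := gi; apply: le_lt_trans.
apply: le_integral => //; first exact: integrable_abse.
by move=> x _; rewrite lee_fin ler_norm.
Qed.

Lemma ae_normr_Rintegral_le f g : integ f -> integ g ->
  (forall x, 0 <= g x) -> {ae P, forall x, `|f x| <= g x} ->
  `|\int[P]_x f x| <= \int[P]_x g x.
Proof.
move=> fi gi g0 fg; apply: (le_trans (le_normr_Rintegral _ fi)) => //.
have mf : measurable_fun setT f by case/integrableP : fi => /measurable_EFinP.
apply: fine_le.
- have ni : integ (fun x => `|f x|) by exact: integrable_norm fi.
  exact: integrable_fin_num ni.
- exact: integrable_fin_num gi.
- exact: ae_normr_integral_le.
Qed.

Lemma integ_powR_add (q : R) f g : 0 <= q ->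
  measurable_fun setT f -> measurable_fun setT g ->
  (forall x, 0 <= f x) -> (forall x, 0 <= g x) ->
  integ (fun x => f x `^ q) -> integ (fun x => g x `^ q) ->
  integ (fun x => (f x + g x) `^ q).
Proof.
move=> q0 mf mg f0 g0 fi gi.
apply: (integ_le (g := fun x => 2 `^ q * (f x `^ q + g x `^ q))).
- by apply: (measurableT_comp (measurable_powR q)); exact: measurable_funD.
- by move=> x; rewrite ger0_norm ?powR_ge0// powR_add_le.
- by apply: integ_scale; exact: integ_add.
Qed.

Lemma Rintegral_expansion (t a : R) f c1 c2 c3 c4 :
  integ f -> integ c1 -> integ c2 -> integ c3 -> integ c4 ->
  \int[P]_x f x - (a + t * \int[P]_x c1 x + t ^+ 2 * \int[P]_x c2 x
     + t ^+ 3 * \int[P]_x c3 x + t ^+ 4 * \int[P]_x c4 x)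
  = \int[P]_x (f x - (a + t * c1 x + t ^+ 2 * c2 x + t ^+ 3 * c3 x
     + t ^+ 4 * c4 x)).
Proof.
move=> fi i1 i2 i3 i4.
have ia := integ_cst a.
have j1 := integ_scale t i1. have j2 := integ_scale (t ^+ 2) i2.
have j3 := integ_scale (t ^+ 3) i3. have j4 := integ_scale (t ^+ 4) i4.
have k1 := integ_add ia j1. have k2 := integ_add k1 j2.
have k3 := integ_add k2 j3. have k4 := integ_add k3 j4.
rewrite RintegralB// RintegralD// RintegralD// RintegralD// RintegralD//.
rewrite !RintegralZl// Rintegral_cst//. 
have -> : fine (P [set: T]) = 1 by rewrite probability_setT.
by rewrite mulr1.
Qed.

End integration.

(** For fixed b each v_i is a random scalar times a fixed vector, so every jet is a polynomial in
    the scalars with deterministic coefficients. *)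
Lemma measurable_jets (R : realType) (disp : measure_display)
    (T : measurableType disp) (V : normedModType R) (D : seq V -> R)
    (X Y Z W : T -> R) (b1 b2 b3 b4 : V) :
  (forall r, (r <= 4)%N -> multilinear r D) ->
  (forall v h, D [:: v; h] = D [:: h; v]) ->
  (forall v h u, D [:: v; h; u] = D [:: h; v; u]) ->
  (forall v h u, D [:: v; h; u] = D [:: v; u; h]) ->
  measurable_fun setT X -> measurable_fun setT Y ->
  measurable_fun setT Z -> measurable_fun setT W ->
  [/\ measurable_fun setT (fun w => D [:: X w *: b1]),
      measurable_fun setT (fun w => jet2 D (X w *: b1) (Y w *: b2)),
      measurable_fun setT (fun w => jet3 D (X w *: b1) (Y w *: b2) (Z w *: b3))
    & measurable_fun setT
        (fun w => jet4 D (X w *: b1) (Y w *: b2) (Z w *: b3) (W w *: b4))].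
Proof.
move=> mD D2C D3C12 D3C23 mX mY mZ mW.
have mM (f : T -> R) (k : R) : measurable_fun setT f ->
    measurable_fun setT (fun w => f w * k).
  by move=> mf; exact: measurable_funM.
split.
- under eq_fun do rewrite (jet1_scale mD).
  exact: mM.
- under eq_fun do rewrite (jet2_scale mD D2C).
  by apply: measurable_funD; apply: mM => //; exact: measurable_funX.
- under eq_fun do rewrite (jet3_scale mD D2C D3C12 D3C23).
  apply: measurable_funD; [apply: measurable_funD|]; apply: mM => //.
    exact: measurable_funM.
  exact: measurable_funX.
- under eq_fun do rewrite (jet4_scale mD D2C D3C12 D3C23).
  have mX2 : measurable_fun setT (fun w => X w ^+ 2) by exact: measurable_funX.
  apply: measurable_funD; [apply: measurable_funD; [apply: measurable_funD;
    [apply: measurable_funD|]|]|]; apply: mM => //.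
  + exact: measurable_funM.
  + exact: measurable_funX.
  + exact: measurable_funM.
  + exact: measurable_funX.
Qed.

(** * The expansion of the expectation *)

Section smooth_jets.
Context {R : realType} {d : nat} (F : 'rV[R]_d -> R) (A : set 'rV[R]_d).
Hypotheses (oA : open A) (A0 : A 0) (FC : Ck_on 4 F A).

Lemma frechetD_bounded (r0 : nat) : (r0 <= 4)%N ->
  exists2 c, 0 <= c & forall r, (r <= r0)%N -> opnorm_le r (frechetD F 0) c.
Proof.
move=> r04.
have /fin_all_exists2[c c0 cD] (r : 'I_r0.+1) := multilinear_bounded
  (multilinear_frechetD oA FC (leq_trans (ltn_ord r) (r04 : (r0.+1 <= 5)%N)) A0).
exists (\sum_r c r); first exact: sumr_ge0.
move=> r; rewrite -ltnS => rr0 w sw; apply: (le_trans (cD (Ordinal rr0) w sw)).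
rewrite ler_wpM2r ?prodr_ge0// (bigD1 (Ordinal rr0))//= lerDl.
by apply: sumr_ge0.
Qed.

Lemma taylor4_frechetD (e : R) : 0 < e -> exists2 r : R, 0 < r &
  forall u, `|u| < r ->
    `|F u - (F 0 + taylor4 (frechetD F 0) u)| <= e * `|u| ^+ 4.
Proof.
move=> e0; have [r r0 H] := taylor_lagrange_frechetD oA FC A0 e0.
exists r => // u /H; rewrite add0r; congr (`|_ - _| <= _).
rewrite -[F 0]/(frechetD F 0 [::]) /taylor4; move: (frechetD F 0) => G.
rewrite !big_ord_recr big_ord0 /= !factS fact0.
by field.
Qed.

End smooth_jets.

Theorem proposition4p1
  (R : realType) (disp : measure_display) (T : measurableType disp)
  (P : probability T R) (d : nat)
  (K : set 'rV[R]_d) (K_compact : compact K)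
  (F : 'rV[R]_d -> R)
  (F_measurable : measurable_fun [set: borel_rV R d] (F : borel_rV R d -> R))
  (F_C4 : exists A : set 'rV[R]_d, [/\ open A, A 0 & Ck_on 4 F A])
  (C D : R) (D_gt0 : 0 < D)
  (F_growth : forall u : 'rV[R]_d, `|F u| <= C * (1 + `|u| `^ D))
  (p q : R) (p_gt : Num.max 4 D < p) (q_gt : Num.max 3 D < q)
  (X Y Z W M : {RV P >-> R})
  (X_Lp : (X : T -> R) \in Lfun P p%:E)
  (Y_Lq : (Y : T -> R) \in Lfun P q%:E)
  (Z_Lq : (Z : T -> R) \in Lfun P q%:E)
  (W_Lq : (W : T -> R) \in Lfun P q%:E)
  (M_Lq : (M : T -> R) \in Lfun P q%:E)
  (M_ge0 : {ae P, forall w, 0 <= M w})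
  (t0 : R) (t0_gt0 : 0 < t0) (CK : R)
  (U Rem : R -> 'rV[R]_d -> T -> 'rV[R]_d)
  (U_measurable : forall (t : R) (b : 'rV[R]_d), `|t| <= t0 -> K b ->
     measurable_fun [set: T] (U t b : T -> borel_rV R d))
  (U_expansion : forall (t : R) (b : 'rV[R]_d) (j : 'I_d), `|t| <= t0 -> K b ->
     {ae P, forall w,
       U t b w 0 j = t * b 0 j * X w
                     + t ^+ 2 * b 0 j ^+ 2 / 2 * Y w
                     + t ^+ 3 * b 0 j ^+ 3 / 6 * Z w
                     + t ^+ 4 * b 0 j ^+ 4 / 24 * W w
                     + Rem t b w 0 j
       /\ `|Rem t b w 0 j| <= CK * `|t| ^+ 5 * M w}) :
  let v1 (b : 'rV[R]_d) (w : T) : 'rV[R]_d := \row_j (b 0 j * X w) in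
  let v2 (b : 'rV[R]_d) (w : T) : 'rV[R]_d := \row_j (b 0 j ^+ 2 * Y w / 2) in
  let v3 (b : 'rV[R]_d) (w : T) : 'rV[R]_d := \row_j (b 0 j ^+ 3 * Z w / 6) in
  let v4 (b : 'rV[R]_d) (w : T) : 'rV[R]_d := \row_j (b 0 j ^+ 4 * W w / 24) in
  let c1 (b : 'rV[R]_d) (w : T) : R := frechetD F 0 [:: v1 b w] in
  let c2 (b : 'rV[R]_d) (w : T) : R :=
    frechetD F 0 [:: v2 b w] + 2^-1 * frechetD F 0 [:: v1 b w; v1 b w] in
  let c3 (b : 'rV[R]_d) (w : T) : R :=
    frechetD F 0 [:: v3 b w] + frechetD F 0 [:: v1 b w; v2 b w]
    + 6^-1 * frechetD F 0 [:: v1 b w; v1 b w; v1 b w] in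
  let c4 (b : 'rV[R]_d) (w : T) : R :=
    frechetD F 0 [:: v4 b w] + frechetD F 0 [:: v1 b w; v3 b w]
    + 2^-1 * frechetD F 0 [:: v2 b w; v2 b w]
    + 2^-1 * frechetD F 0 [:: v1 b w; v1 b w; v2 b w]
    + 24^-1 * frechetD F 0 [:: v1 b w; v1 b w; v1 b w; v1 b w] in
  [/\ forall (t : R) (b : 'rV[R]_d), `|t| <= t0 -> K b ->
        P.-integrable [set: T] (fun w => (F (U t b w))%:E),
      forall b : 'rV[R]_d, K b ->
        [/\ P.-integrable [set: T] (EFin \o c1 b),
            P.-integrable [set: T] (EFin \o c2 b),
            P.-integrable [set: T] (EFin \o c3 b)
          & P.-integrable [set: T] (EFin \o c4 b)]
    & forall e : R, 0 < e -> \forall t \near (0 : R),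
        forall b : 'rV[R]_d, K b ->
          `| fine 'E_P[fun w => F (U t b w)]
             - (F 0 + t * fine 'E_P[c1 b]
                + t ^+ 2 * fine 'E_P[c2 b]
                + t ^+ 3 * fine 'E_P[c3 b]
                + t ^+ 4 * fine 'E_P[c4 b]) | <= e * t ^+ 4].
Proof.
move=> v1 v2 v3 v4 c1 c2 c3 c4.
have [A [oA A0 FC]] := F_C4.
pose D0 := frechetD F 0.
have mD r : (r <= 4)%N -> multilinear r D0.
  by move=> r4; exact: multilinear_frechetD oA FC r4 A0.
have [c c_ge0 bD] := frechetD_bounded oA A0 FC (leqnn 4).
have D2C v h : D0 [:: v; h] = D0 [:: h; v].
  exact: frechetD_swap oA FC _ (erefl : size [::] = 0%N) A0.
have D3C12 v h u : D0 [:: v; h; u] = D0 [:: h; v; u].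
  exact: frechetD_swap oA FC _ (erefl : size [:: u] = 1%N) A0.
(* Symmetry of D^2 F is used at every point of [A] and then differentiated. *)
have D3C23 v h u : D0 [:: v; h; u] = D0 [:: v; u; h].
  apply: (@frechetD_cons_eq _ _ 4 F A 2) => // y Ay.
  exact: frechetD_swap oA FC _ (erefl : size [::] = 0%N) Ay.
have [p4 pD] : 4 < p /\ D < p by move: p_gt; rewrite gt_max => /andP[].
have [q3 qD] : 3 < q /\ D < q by move: q_gt; rewrite gt_max => /andP[].
have p1 : 1 <= p by rewrite (le_trans _ (ltW p4))// ler1n.
have q1 : 1 <= q by rewrite (le_trans _ (ltW q3))// ler1n.
have q0 : 0 <= q := le_trans ler01 q1.
pose a w := `|X w|.
pose b' w := (`|Y w| + `|Z w|) + (`|W w| + `|M w|).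
(* One integrable majorant, free of t and b, serves integrability and the error term alike. *)
pose Q w := 1 + a w `^ p + b' w `^ q.
have a0 w : 0 <= a w by exact: normr_ge0.
have b0 w : 0 <= b' w by rewrite !addr_ge0.
have Q0 w : 0 <= Q w by rewrite !addr_ge0// powR_ge0.
have mN (V : {RV P >-> R}) : measurable_fun setT (fun w => `|V w|).
  exact: measurableT_comp.
have mV (V : {RV P >-> R}) : measurable_fun setT (V : T -> R) by [].
have iQ : P.-integrable setT (EFin \o Q).
  apply: integ_add; first apply: integ_add; first exact: integ_cst.
    exact: Lfun_integrable p1 X_Lp.
  have iN (V V' : {RV P >-> R}) : (V : T -> R) \in Lfun P q%:E ->
      (V' : T -> R) \in Lfun P q%:E ->
      P.-integrable setT (EFin \o (fun w => (`|V w| + `|V' w|) `^ q)).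
    by move=> Vq V'q; apply: integ_powR_add => //; exact: Lfun_integrable.
  apply: (integ_powR_add q0 _ _ _ _ (iN _ _ Y_Lq Z_Lq) (iN _ _ W_Lq M_Lq)).
  - exact: measurable_funD.
  - exact: measurable_funD.
  - by move=> w; rewrite addr_ge0.
  - by move=> w; rewrite addr_ge0.
have [m m1 Km] : exists2 m, 1 <= m & forall b, K b -> forall j, `|b 0 j| <= m.
  have [m [_ mK]] := compact_bounded K_compact.
  exists (`|m| + 1); first by rewrite lerDr.
  move=> b Kb j; apply: (le_trans (coord_le_norm _ _)); apply: mK => //.
  by rewrite (le_lt_trans (ler_norm m))// ltrDl.
(* As m >= 1, m^4 bounds all |b_j|^i with i <= 4; the absolute value allows any sign of [CK]. *)
pose k := m ^+ 4 + `|CK|.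
have k1 : 1 <= k by rewrite (le_trans (exprn_ege1 4 m1))// lerDl.
have k0 : 0 <= k := le_trans ler01 k1.
have bk b i j : K b -> (i <= 4)%N -> `|b 0 j ^+ i| <= k.
  move=> Kb i4; rewrite normrX; apply: (@le_trans _ _ (m ^+ i)).
    by rewrite lerXn2r ?nnegrE ?Km// (le_trans ler01).
  by rewrite (le_trans (ler_weXn2l m1 i4))// lerDl.
have hdiv (x y n : R) : `|x| <= k -> 1 <= n -> `|x * y / n| <= k * `|y|.
  move=> xk n1; have n0 : 0 < n := lt_le_trans ltr01 n1.
  rewrite !normrM normfV (gtr0_norm n0) ler_pdivrMr// -[leLHS]mulr1.
  by rewrite !ler_pM// mulr_ge0.
have hYb w : `|Y w| <= b' w by rewrite /b' -!addrA lerDl !addr_ge0.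
have hZb w : `|Z w| <= b' w by rewrite /b' [`|Y w| + _]addrC -!addrA lerDl !addr_ge0.
have hWb w : `|W w| <= b' w by rewrite /b' addrC -!addrA lerDl !addr_ge0.
have hMb w : `|M w| <= b' w.
  by rewrite /b' addrC [`|W w| + _]addrC -!addrA lerDl !addr_ge0.
have h1 b w : K b -> `|v1 b w| <= k * a w.
  move=> Kb; apply: norm_rV_le => [|j]; first by rewrite mulr_ge0.
  by rewrite mxE normrM ler_wpM2r// -[b 0 j]expr1 bk.
have h2 b w : K b -> `|v2 b w| <= k * b' w.
  move=> Kb; apply: norm_rV_le => [|j]; first by rewrite mulr_ge0.
  rewrite mxE; apply: (le_trans (hdiv _ _ _ _ _)); first exact: bk.
    by rewrite ler1n.
  by rewrite ler_wpM2l.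
have h3 b w : K b -> `|v3 b w| <= k * b' w.
  move=> Kb; apply: norm_rV_le => [|j]; first by rewrite mulr_ge0.
  rewrite mxE; apply: (le_trans (hdiv _ _ _ _ _)); first exact: bk.
    by rewrite ler1n.
  by rewrite ler_wpM2l.
have h4 b w : K b -> `|v4 b w| <= k * b' w.
  move=> Kb; apply: norm_rV_le => [|j]; first by rewrite mulr_ge0.
  rewrite mxE; apply: (le_trans (hdiv _ _ _ _ _)); first exact: bk.
    by rewrite ler1n.
  by rewrite ler_wpM2l.
have U_ae t b : `|t| <= t0 -> K b -> {ae P, forall w,
    U t b w = t *: v1 b w + (t ^+ 2 *: v2 b w + (t ^+ 3 *: v3 b w
      + (t ^+ 4 *: v4 b w + Rem t b w)))
    /\ `|Rem t b w| <= k * `|t| ^+ 5 * b' w}.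
  (* The almost sure statements for the finitely many coordinates are intersected. *)
  move=> tt0 Kb; have H := @filter_forall T 'I_d _ (almost_everywhere P)
    (ae_filter_ringOfSetsType P) (fun j => U_expansion t b j tt0 Kb).
  apply: filterS H => w Hw; split.
    by apply/rowP => j; rewrite (Hw j).1 !mxE; ring.
  apply: norm_rV_le => [|j]; first by rewrite !mulr_ge0// exprn_ge0.
  apply: (le_trans (Hw j).2); apply: (le_trans (ler_norm _)).
  rewrite normrM normrM normrX normr_id ler_pM// ?mulr_ge0 ?exprn_ge0//.
  by rewrite ler_wpM2r ?exprn_ge0// lerDr exprn_ge0// (le_trans ler01).
have F_int t b : `|t| <= t0 -> K b ->
    P.-integrable [set: T] (fun w => (F (U t b w))%:E).
  move=> tt0 Kb.
  have mFU : measurable_fun setT (fun w => F (U t b w)).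
    exact: measurableT_comp F_measurable (U_measurable t b tt0 Kb).
  (* Integrability is claimed for all |t| <= t0, so the powers of |t| are bounded crudely by [s]. *)
  pose s := (1 + t0) ^+ 5.
  have s0 : 0 <= s by rewrite exprn_ge0// addr_ge0// ltW.
  have ts i : (i <= 5)%N -> `|t| ^+ i <= s.
    move=> i5; apply: (@le_trans _ _ ((1 + t0) ^+ i)).
      rewrite lerXn2r ?nnegrE// ?addr_ge0 ?(ltW t0_gt0)//.
      by rewrite (le_trans tt0)// lerDr.
    by rewrite ler_weXn2l// lerDl ltW.
  have sv i v x : (i <= 5)%N -> `|v : 'rV[R]_d| <= k * x -> 0 <= x ->
      `|t ^+ i *: v| <= s * (k * x).
    move=> i5 vx x0; rewrite normrZ normrX; apply: ler_pM => //; exact: ts.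
  pose k' := 4 * (s * k).
  have k'0 : 0 <= k' by rewrite mulr_ge0// mulr_ge0.
  apply: (@integ_ae_le _ _ _ P _
    (fun w => C * (1 + 2 * (2 * k') `^ D) * Q w)) => //.
  - exact: integ_scale.
  - move=> w; apply: mulr_ge0 => //; apply: mulr_ge0.
      have := le_trans (normr_ge0 _) (F_growth 0).
      by rewrite normr0 powR0 ?gt_eqF// addr0 mulr1.
    by rewrite addr_ge0// mulr_ge0// powR_ge0.
  apply: filterS (U_ae t b tt0 Kb) => w [Uw Rw].
  apply: (growth_le D_gt0 F_growth) => //.
  rewrite Uw /k'.
  have n1 : `|t *: v1 b w| <= s * (k * a w) by have := sv 1%N _ _ isT (h1 b w Kb) (a0 w).
  have n2 := sv 2%N _ _ isT (h2 b w Kb) (b0 w).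
  have n3 := sv 3%N _ _ isT (h3 b w Kb) (b0 w).
  have n4 := sv 4%N _ _ isT (h4 b w Kb) (b0 w).
  have n5 : `|Rem t b w| <= s * (k * b' w).
    apply: (le_trans Rw); rewrite mulrAC [k * _ * _]mulrC.
    by rewrite ler_wpM2r ?mulr_ge0// ts.
  apply: (le_trans (ler_normD _ _)).
  apply: (le_trans (lerD n1 (ler_normD _ _))).
  apply: (le_trans (lerD (lexx _) (lerD n2 (ler_normD _ _)))).
  apply: (le_trans (lerD (lexx _) (lerD (lexx _) (lerD n3 (ler_normD _ _))))).
  apply: (le_trans (lerD (lexx _) (lerD (lexx _) (lerD (lexx _) (lerD n4 n5))))).
  have skx : 0 <= s * (k * a w) by rewrite mulr_ge0// mulr_ge0.
  by move: skx; move: (s) (k) (a w) (b' w) => s' k'' a' b''; lra.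
have c_int b : K b -> [/\ P.-integrable [set: T] (EFin \o c1 b),
    P.-integrable [set: T] (EFin \o c2 b), P.-integrable [set: T] (EFin \o c3 b)
  & P.-integrable [set: T] (EFin \o c4 b)].
  move=> Kb.
  pose be i (n : R) : 'rV[R]_d := \row_j (b 0 j ^+ i / n).
  have v1E w : v1 b w = X w *: b by apply/rowP => j; rewrite !mxE mulrC.
  have v2E w : v2 b w = Y w *: be 2%N 2 by apply/rowP => j; rewrite !mxE; ring.
  have v3E w : v3 b w = Z w *: be 3%N 6 by apply/rowP => j; rewrite !mxE; ring.
  have v4E w : v4 b w = W w *: be 4%N 24 by apply/rowP => j; rewrite !mxE; ring.
  have iB : P.-integrable setT (EFin \o (fun w => 45 * c * k ^+ 4 * Q w)).
    exact: integ_scale.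
  have cQ w := jets_le c_ge0 bD p4 q3 k1 (a0 w) (b0 w) (h1 b w Kb) (h2 b w Kb)
    (h3 b w Kb) (h4 b w Kb).
  have [m1' m2' m3' m4'] := measurable_jets b (be 2%N 2) (be 3%N 6) (be 4%N 24)
    mD D2C D3C12 D3C23 (mV X) (mV Y) (mV Z) (mV W).
  have c1E : c1 b = fun w => D0 [:: X w *: b].
    by apply/funext => w; rewrite -v1E.
  have c2E : c2 b = fun w => jet2 D0 (X w *: b) (Y w *: be 2%N 2).
    by apply/funext => w; rewrite -v1E -v2E.
  have c3E : c3 b = fun w => jet3 D0 (X w *: b) (Y w *: be 2%N 2) (Z w *: be 3%N 6).
    by apply/funext => w; rewrite -v1E -v2E -v3E.
  have c4E : c4 b = fun w => jet4 D0 (X w *: b) (Y w *: be 2%N 2)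
      (Z w *: be 3%N 6) (W w *: be 4%N 24).
    by apply/funext => w; rewrite -v1E -v2E -v3E -v4E.
  rewrite -c1E in m1'; rewrite -c2E in m2'; rewrite -c3E in m3'; rewrite -c4E in m4'.
  split; [apply: (integ_le m1') iB => w|apply: (integ_le m2') iB => w
    |apply: (integ_le m3') iB => w|apply: (integ_le m4') iB => w].
  - by have [H _ _ _] := cQ w; exact: H.
  - by have [_ H _ _] := cQ w; exact: H.
  - by have [_ _ H _] := cQ w; exact: H.
  - by have [_ _ _ H] := cQ w; exact: H.
split=> // e e0.
(* Integrating [e' * t ^+ 4 * Q] must give at most [e * t ^+ 4]; the added 1 keeps the divisor
   positive. *)
pose e' := e / (1 + \int[P]_w Q w).
have IQ0 : 0 <= \int[P]_w Q w by apply: Rintegral_ge0.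
have e'0 : 0 < e' by rewrite divr_gt0// ltr_wpDr.
have [r r0 Hr] := uniform_expansion c_ge0 mD bD D2C D3C12 D3C23 D_gt0 F_growth
  p4 pD q3 qD (taylor4_frechetD oA A0 FC) k1 e'0.
have F_ae t b : `|t| <= t0 -> `|t| <= r -> K b -> {ae P, forall w,
    `|F (U t b w) - (F 0 + t * c1 b w + t ^+ 2 * c2 b w + t ^+ 3 * c3 b w
      + t ^+ 4 * c4 b w)| <= e' * t ^+ 4 * Q w}.
  move=> tt0 tr Kb; apply: filterS (U_ae t b tt0 Kb) => w [Uw Rw]; rewrite Uw.
  exact: (Hr t (a w) (b' w) _ _ _ _ _ tr (a0 w) (b0 w) (h1 b w Kb) (h2 b w Kb)
    (h3 b w Kb) (h4 b w Kb) Rw).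
(* Unification would otherwise unfold the differentials. *)
clearbody c1 c2 c3 c4.
near=> t => b Kb.
have tt0 : `|t| <= t0 by near: t; exact: (@nbhs0_le _ R^o _ t0_gt0).
have tr : `|t| <= r by near: t; exact: (@nbhs0_le _ R^o _ r0).
have [i1 i2 i3 i4] := c_int b Kb.
have EE (f : T -> R) : fine 'E_P[f] = \int[P]_w f w by rewrite unlock.
rewrite !EE.
rewrite (@Rintegral_expansion _ _ _ P t (F 0) (fun w => F (U t b w)) _ _ _ _
  (F_int t b tt0 Kb) i1 i2 i3 i4).
have t4 : 0 <= t ^+ 4 by rewrite -[4%N]/(2 * 2)%N exprM sqr_ge0.
have e't : 0 <= e' * t ^+ 4 by rewrite mulr_ge0// ltW.
have mle : \int[P]_w (e' * t ^+ 4 * Q w) <= e * t ^+ 4.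
  rewrite RintegralZl// mulrAC ler_wpM2r// /e' mulrAC ler_pdivrMr ?ltr_wpDr//.
  by rewrite ler_wpM2l ?(ltW e0)// ler_wpDl.
apply: (le_trans _ mle); apply: ae_normr_Rintegral_le.
- have j1 := integ_scale t i1. have j2 := integ_scale (t ^+ 2) i2.
  have j3 := integ_scale (t ^+ 3) i3. have j4 := integ_scale (t ^+ 4) i4.
  have J := integ_add (integ_add (integ_add (integ_add (integ_cst P (F 0)) j1) j2) j3) j4.
  exact: integ_sub (F_int t b tt0 Kb) J.
- exact: integ_scale.
- by move=> w; rewrite mulr_ge0.
- exact: F_ae.
Unshelve. all: by end_near.
Qed.
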